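(* (i) Let $W:\mathcal X\to\mathcal Y$ be any Bernoulli-reducible memoryless channel, i.e. its image $W(\mathcal X)=\{W(\cdot|x):x\in\mathcal X\}$ contains a non-trivial continuous curve of output distributions. Then $\dot C_{\mathrm{DI}}(W)\ge\frac12$. (ii) Let $Q$ be a memoryless channel with continuous input alphabet and discrete output alphabet whose image is the union of a finite (positive) number of non-trivial continuous curves and a residual set of upper Minkowski dimension at most $1$, and whose image has Minkowski dimension $d_M=1$. Let $P$ be the Poisson channel and $G$ the additive white Gaussian noise channel, each under a peak or average power constraint. Then $$\dot C_{\mathrm{DI}}(Q)=\dot C_{\mathrm{DI}}(P)=\dot C_{\mathrm{DI}}(G)=\frac12 .$$
   Context: A channel $W:\mathcal X\to\mathcal Y$ assigns to each $x\in\mathcal X$ a probability measure $W(\cdot|x)$ on $\mathcal Y$. Channels are memoryless: on input $x^n=(x_1,\dots,x_n)$ the output $Y^n$ has independent coordinates with $Y_i\sim W(\cdot|x_i)$; its law is $W^n(\cdot|x^n)$. A non-trivial continuous curve in the space $\mathcal P(\mathcal Y)$ of probability measures is the image of a non-constant map $[0,1]\to\mathcal P(\mathcal Y)$ continuous in total variation distance (equivalently, in Hellinger distance). Minkowski (box-counting) dimensions of subsets of $\mathcal P(\mathcal Y)$ are taken with respect to the Hellinger distance $h(p,q)=\|\sqrt p-\sqrt q\|_2$. The upper Minkowski dimension of a set is $\limsup_{\varepsilon\to0}\frac{\log \Gamma(\varepsilon)}{\log(1/\varepsilon)}$, where $\Gamma(\varepsilon)$ is the minimal number of $\varepsilon$-balls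 covering it; the Minkowski dimension is the limit when it exists. The Poisson channel $P$: input $x\ge0$, output $y\in\{0,1,2,\dots\}$ with probability $e^{-x}x^y/y!$; constraint: $0\le x_i\le A$ for all $i$ (peak), or $\frac1n\sum_i x_i\le A$ (average), for a fixed $A>0$. The Gaussian channel $G$: input $x\in\mathbb R$, output $Y=x+Z$ with $Z\sim\mathcal N(0,\sigma^2)$, $\sigma^2>0$ fixed; constraint: $x_i^2\le A$ for all $i$ (peak), or $\frac1n\sum_i x_i^2\le A$ (average), for a fixed $A>0$. An $(n,N,\lambda_1,\lambda_2)$ deterministic identification (DI) code for $W$ is a family $\{(u_i,\mathcal D_i): i\in[N]\}$ with $u_i\in\mathcal X^n$ (satisfying the power constraint, if any) and (measurable) $\mathcal D_i\subset\mathcal Y^n$, possibly overlapping, such that for all distinct $i,j\in[N]$: $W^n(\mathcal D_i|u_i)\ge 1-\lambda_1$ and $W^n(\mathcal D_j|u_i)\le\lambda_2$. A number $\dot R>0$ is an achievable linearithmic rate for $W$ if there is a sequence of $(n,N^{(n)},\lambda_1^{(n)},\lambda_2^{(n)})$ DI codes with $\lambda_1^{(n)},\lambda_2^{(n)}\to0$ and $\frac{\log N^{(n)}}{n\log n}\to\dot R$. The linearithmic DI capacity $\dot C_{\mathrm{DI}}(W)$ is the largest achievable linearithmic rate (understood as $+\infty$ if achievable rates are unbounded). *)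

(* Defs.v *)
From HB Require Import structures.
From mathcomp Require Import all_boot all_order all_algebra.
From mathcomp Require Import all_classical all_reals all_analysis.

Set Implicit Arguments.
Unset Strict Implicit.
Unset Printing Implicit Defensive.

Import Order.TTheory GRing.Theory Num.Theory.
Import numFieldNormedType.Exports.

Local Open Scope classical_set_scope.
Local Open Scope ring_scope.

Section product_law.
Context {R : realType} {d : measure_display} {Y : measurableType d}.

Definition tuple_cons (n : nat) (z : Y * n.-tuple Y) : n.+1.-tuple Y :=
  [the n.+1.-tuple Y of z.1 :: z.2].

Lemma measurable_tuple_cons (n : nat) :
  measurable_fun [set: Y * n.-tuple Y] (@tuple_cons n).
Proof. exact: measurable_cons. Qed.

HB.instance Definition _ (n : nat) :=
  isMeasurableFun.Build _ _ _ _ (@tuple_cons n) (@measurable_tuple_cons n).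

(* law of (Y_0, ..., Y_(n-1)) with independent coordinates Y_i ~ P i *)
Fixpoint product_law (n : nat) :
    ('I_n -> probability Y R) -> probability (n.-tuple Y) R :=
  match n with
  | 0 => fun=> \d_[tuple]
  | m.+1 => fun P =>
      distribution (P ord0 \x product_law (fun i => P (lift ord0 i)))%E
                   (@tuple_cons m)
  end.

Lemma measurable_box (n : nat) (A : 'I_n -> set Y) :
  (forall i, measurable (A i)) ->
  measurable [set y : n.-tuple Y | forall i, A i (tnth y i)].
Proof.
move=> mA; rewrite (_ : [set _ | _] =
    \bigcap_(i in [set: 'I_n]) ((fun y : n.-tuple Y => tnth y i) @^-1` A i)).
  apply: fin_bigcap_measurable => [|i _]; first exact: finite_finset.
  by rewrite -[X in measurable X]setTI; exact: measurable_tnth.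
by apply/seteqP; split => y /= h i; [move=> _|]; exact: h.
Qed.

Lemma product_law_box (n : nat) (P : 'I_n -> probability Y R)
    (A : 'I_n -> set Y) : (forall i, measurable (A i)) ->
  product_law P [set y | forall i, A i (tnth y i)] = (\prod_(i < n) P i (A i))%E.
Proof.
elim: n P A => [|n IHn] P A mA.
  by rewrite big_ord0 /= diracE mem_set//=; case.
rewrite big_ord_recl -IHn// /=.
rewrite /distribution /pushforward /= -product_measure1E//; last first.
  by apply: (measurable_box (A := fun i => A (lift ord0 i))) => i; exact: mA.
congr (_ _); apply/seteqP; split => -[y0 y] /=.
  move=> h; split=> [|i]; first by have := h ord0; rewrite tnth0.
  by have := h (lift ord0 i); rewrite tnthS.
case=> h0 h i; case: (unliftP ord0 i) => [j ->|->].
  by rewrite tnthS.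
by rewrite tnth0.
Qed.

End product_law.

Section output_distributions.
Context {R : realType} {d : measure_display} {Y : measurableType d}.
Implicit Types (p q : probability Y R) (E : set (probability Y R)).

(* A probability is a function on all subsets of Y whose values on
   non-measurable sets are irrelevant, so Leibniz equality is too fine. *)
Definition same_law p q := forall A, measurable A -> p A = q A.

Definition tv_distance p q : R :=
  sup [set `|fine (p A) - fine (q A)| | A in measurable].

Definition nontrivial_curve E :=
  exists g : R -> probability Y R,
    [/\ {in `[0, 1], forall t,
          tv_distance (g t) (g s) @[s --> within `[0, 1] (nbhs t)] --> (0 : R)},
        exists s t, [/\ s \in `[0, 1], t \in `[0, 1] & ~ same_law (g s) (g t)]
      & E = [set p | exists2 t, t \in `[0, 1] & same_law (g t) p]].

(* ||sqrt p - sqrt q||_2, densities being taken with respect to the counting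
   measure: this is meant for a discrete alphabet Y *)
Definition hellinger p q : R :=
  Num.sqrt (fine (\esum_(y in [set: Y])
    ((Num.sqrt (fine (p [set y])) - Num.sqrt (fine (q [set y]))) ^+ 2)%:E)).

(* +oo when there is no finite covering *)
Definition covering_number E (eps : R) : \bar R :=
  ereal_inf [set (N%:R)%:E | N in [set N : nat |
    exists c : 'I_N -> probability Y R,
      forall p, E p -> exists i, hellinger (c i) p < eps]].

(* lne 0 = -oo: the dimension of the empty set is -oo *)
Definition entropy_ratio E (eps : R) : \bar R :=
  (lne (covering_number E eps) * ((ln eps^-1)^-1)%:E)%E.

Definition upper_minkowski_dim E : \bar R :=
  limf_esup (entropy_ratio E) (0 : R)^'+.

Definition has_minkowski_dim E (D : R) :=
  entropy_ratio E eps @[eps --> (0 : R)^'+] --> D%:E.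

End output_distributions.

Definition discrete_alphabet (d : measure_display) (Y : measurableType d) :=
  countable [set: Y] /\ forall A : set Y, measurable A.

Section channels.
Context {R : realType} {X : Type} {d : measure_display} {Y : measurableType d}.
Variable W : X -> probability Y R.

Definition channel_image : set (probability Y R) :=
  [set p | exists x, same_law (W x) p].

Definition bernoulli_reducible :=
  exists2 C, nontrivial_curve C & C `<=` channel_image.

Definition memoryless (n : nat) (u : n.-tuple X) : probability (n.-tuple Y) R :=
  product_law (fun i => W (tnth u i)).

Definition input_constraint := forall n : nat, set (n.-tuple X).

Variable K : input_constraint.

Definition DI_code (n N : nat) (l1 l2 : R) :=
  exists (u : 'I_N -> n.-tuple X) (D : 'I_N -> set (n.-tuple Y)),
    [/\ forall i, K (u i),
        forall i, measurable (D i)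
      & forall i j, i != j ->
          ((1 - l1)%:E <= memoryless (u i) (D i))%E /\
          (memoryless (u i) (D j) <= l2%:E)%E].

Definition achievable_linearithmic_rate (r : R) :=
  0 < r /\
  exists (N : nat -> nat) (l1 l2 : nat -> R),
    [/\ forall n, DI_code n (N n) (l1 n) (l2 n),
        l1 n @[n --> \oo] --> (0 : R),
        l2 n @[n --> \oo] --> (0 : R)
      & ln (N n)%:R / (n%:R * ln n%:R) @[n --> \oo] --> r].

Definition linearithmic_DI_capacity : \bar R :=
  ereal_sup [set r%:E | r in achievable_linearithmic_rate].

End channels.

Definition unconstrained {X : Type} : input_constraint (X := X) :=
  fun=> setT.

Section poisson_channel.
Context {R : realType}.

(* the second argument of poisson_prob is a dummy *)
Definition poisson_channel (x : {nonneg R}) : probability nat R :=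
  poisson_prob x%:num 0%N.

Lemma poisson_channelE (x : {nonneg R}) (y : nat) :
  poisson_channel x [set y] = (expR (- x%:num) * x%:num ^+ y / y`!%:R)%:E.
Proof.
rewrite /poisson_channel /= /poisson_prob; case: ifPn => [x0|].
  rewrite esum_set1; last by rewrite lee_fin poisson_pmf_ge0.
  by rewrite /poisson_pmf x0 mulrC mulrA.
rewrite lt_neqAle ge0 andbT negbK => /eqP <-.
rewrite oppr0 expR0 mul1r diracE.
case: y => [|y]; first by rewrite mem_set// expr0 fact0 divr1.
by rewrite memNset// expr0n mul0r.
Qed.

Definition poisson_peak (A : R) : input_constraint (X := {nonneg R}) :=
  fun n => [set u | forall i, (tnth u i)%:num <= A].

Definition poisson_average (A : R) : input_constraint (X := {nonneg R}) :=
  fun n => [set u | n%:R^-1 * \sum_(i < n) (tnth u i)%:num <= A].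

End poisson_channel.

Section gaussian_channel.
Context {R : realType}.

Definition additive (x : R) : measurableTypeR R -> measurableTypeR R :=
  fun z => x + z.

Lemma measurable_additive (x : R) : measurable_fun setT (additive x).
Proof. by apply: measurable_realfun.measurable_funD. Qed.

HB.instance Definition _ (x : R) :=
  isMeasurableFun.Build _ _ _ _ (additive x) (measurable_additive x).

(* the law of x + Z for Z ~ N(0, sigma^2) *)
Definition gaussian_channel (sigma x : R) : probability (measurableTypeR R) R :=
  distribution (normal_prob 0 sigma) (additive x).

Definition gaussian_peak (A : R) : input_constraint (X := R) :=
  fun n => [set u | forall i, tnth u i ^+ 2 <= A].

Definition gaussian_average (A : R) : input_constraint (X := R) :=
  fun n => [set u | n%:R^-1 * \sum_(i < n) tnth u i ^+ 2 <= A].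

End gaussian_channel.

(* Main.v *)
Require Import Defs.
From mathcomp Require Import all_boot all_order all_algebra.
From mathcomp Require Import all_classical all_reals all_analysis.
From mathcomp Require Import measurable_realfun ring lra.

(** Upper bound.  Two codewords whose output laws are close in Hellinger affinity
    cannot be told apart, and affinity is multiplicative over the coordinates.
    Quantizing the square root of the output density in each coordinate at scale
    [1 / sqrt n] therefore maps distinct codewords to distinct cells, and there
    are only [n ^ (n / 2 + o n)] cells; under an average power constraint the
    cells are counted by integer vectors whose coordinates sum to
    [O(n * sqrt n)].

    Lower bound.  A curve of output laws contains Bernoulli parameters filling an
    interval [[a, b]].  The codewords are
    [a + (b - a) Q^-L * \sum_l Q ^ l * x_l] for digit vectors
    [x_l \in {0 .. q - 1} ^ n], [l < L], where the [x_l] range over a code of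
    linear Hamming distance and all codewords have the same Gram matrix
    [(<x_l, x_m>)]; by pigeonhole the latter only costs a polynomial factor.  As on
    nested spheres, if [l] is the top level at which two codewords differ, then
    [<x_l, x_l - y_l> = |x_l - y_l| ^ 2 / 2] dominates the lower levels, so the
    linear statistic with weights [x_l] separates the two.  Each decoder
    thresholds only [L] linear statistics, and the rate tends to [1 / 2] as [L]
    grows. *)

Set Implicit Arguments.
Unset Strict Implicit.
Unset Printing Implicit Defensive.

Import Order.TTheory GRing.Theory Num.Theory.
Import numFieldNormedType.Exports.

Local Open Scope classical_set_scope.
Local Open Scope ring_scope.

(** * Integration against product laws *)

Section product_law_integral.
Context {R : realType} {d : measure_display} {Y : measurableType d}.
Local Open Scope ereal_scope.

Lemma ge0_integral_product_lawS (n : nat) (P : 'I_n.+1 -> probability Y R)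
    (f : n.+1.-tuple Y -> \bar R) :
  measurable_fun setT f -> (forall y, 0 <= f y) ->
  \int[product_law P]_y f y =
  \int[P ord0]_y0 \int[product_law (fun i => P (lift ord0 i))]_y
    f (tuple_cons (y0, y)).
Proof.
move=> mf f0 /=; rewrite ge0_integral_pushforward//=.
by rewrite fubini_tonelli1//=; exact: measurableT_comp.
Qed.

Lemma ge0_integral_product_lawM (n : nat) (P : 'I_n -> probability Y R)
    (f : 'I_n -> Y -> \bar R) :
  (forall i, measurable_fun setT (f i)) -> (forall i y, 0 <= f i y) ->
  \int[product_law P]_y \prod_(i < n) f i (tnth y i) =
  \prod_(i < n) \int[P i]_y f i y.
Proof.
elim: n P f => [|n IHn] P f mf f0.
  rewrite big_ord0; under eq_integral do rewrite big_ord0.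
  by rewrite integral_cst//= mul1e probability_setT.
have mprod m (g : 'I_m -> Y -> \bar R) : (forall i, measurable_fun setT (g i)) ->
    measurable_fun setT (fun y : m.-tuple Y => \prod_(i < m) g i (tnth y i)).
  move=> mg; elim: (index_enum _) => [|i s IHs].
    by under eq_fun do rewrite big_nil; exact: measurable_cst.
  under eq_fun do rewrite big_cons; apply: emeasurable_funM => //.
  exact: (measurableT_comp (mg i) (measurable_tnth i)).
have prod_ge0 m (g : 'I_m -> Y -> \bar R) (y : m.-tuple Y) :
    (forall i y, 0 <= g i y) -> 0 <= \prod_(i < m) g i (tnth y i).
  by move=> g0; elim/big_ind: _ => // *; exact: mule_ge0.
rewrite ge0_integral_product_lawS; [|exact: mprod|by move=> y; exact: prod_ge0].
have prod_cons (y0 : Y) (y : n.-tuple Y) :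
    \prod_(i < n.+1) f i (tnth (tuple_cons (y0, y)) i) =
    f ord0 y0 * \prod_(i < n) f (lift ord0 i) (tnth y i).
  rewrite big_ord_recl tnth0; congr (_ * _).
  by apply: eq_bigr => i _; rewrite tnthS.
rewrite big_ord_recl -(IHn _ (fun i => f (lift ord0 i)))//.
under eq_integral do under eq_integral do rewrite prod_cons.
pose I := \int[product_law (fun i => P (lift ord0 i))]_y
  \prod_(i < n) f (lift ord0 i) (tnth y i).
have I0 : 0 <= I.
  by apply: integral_ge0 => y _; exact: (prod_ge0 _ (fun i => f (lift ord0 i))).
rewrite -/I -ge0_integralZr//; apply: eq_integral => y0 _.
rewrite ge0_integralZl//; first exact: (mprod _ (fun i => f (lift ord0 i))).
by move=> y _; exact: (prod_ge0 _ (fun i => f (lift ord0 i))).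
Qed.

End product_law_integral.

(** Dual form of a lower bound on the squared Bhattacharyya coefficient, which is the infimum of
    [(\int f dP) (\int g dQ)] over pairs with [f g >= 1]. It refers to no density, so it serves
    discrete and Gaussian outputs alike. The bound [c] keeps both integrals positive, so that the
    convention [0 * +oo = 0] cannot spoil the product. *)
Definition affinity_ge {R : realType} {d : measure_display}
    {Y : measurableType d} (P Q : probability Y R) (r : R) :=
  forall (c : R) (f g : Y -> \bar R), 0 < c ->
    measurable_fun setT f -> measurable_fun setT g ->
    (forall y, (c%:E <= f y)%E) -> (forall y, (c%:E <= g y)%E) ->
    (forall y, (1 <= f y * g y)%E) ->
  (r%:E <= (\int[P]_y f y) * (\int[Q]_y g y))%E.

(** * Tensorization of affinity and its effect on tests *)

Section affinity.
Context {R : realType}.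
Local Open Scope ereal_scope.

Lemma integral_ge_cst {d : measure_display} {Y : measurableType d}
    (P : probability Y R) (c : R) (f : Y -> \bar R) :
  (0 < c)%R -> measurable_fun setT f -> (forall y, c%:E <= f y) ->
  c%:E <= \int[P]_y f y.
Proof.
move=> c0 mf cf.
have <- : \int[P]_y c%:E = c%:E.
  by rewrite integral_cst//= probability_setT mule1.
by apply: ge0_le_integral => //= y _; rewrite lee_fin ltW.
Qed.

(** Induction on [n] through Tonelli: for fixed first letters the inner integrals [F] and [G]
    satisfy [s <= F * G] by the induction hypothesis, so [F / s] and [G] form an admissible pair for
    the first coordinate. *)
Lemma affinity_ge_product {d : measure_display} {Y : measurableType d} (n : nat)
    (P Q : 'I_n -> probability Y R) (r : 'I_n -> R) :
  (forall i, (0 < r i)%R) -> (forall i, affinity_ge (P i) (Q i) (r i)) ->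
  affinity_ge (product_law P) (product_law Q) (\prod_(i < n) r i)%R.
Proof.
elim: n P Q r => [|n IHn] P Q r r0 PQ c f g c0 mf mg cf cg fg.
  by rewrite big_ord0 /= !integral_dirac// !diracT !mul1e.
have fge0 y : 0 <= f y by apply: le_trans (cf y); rewrite lee_fin ltW.
have gge0 y : 0 <= g y by apply: le_trans (cg y); rewrite lee_fin ltW.
rewrite !ge0_integral_product_lawS// big_ord_recl.
set s := (\prod_(i < n) _)%R.
have s0 : (0 < s)%R by apply: prodr_gt0.
pose F y0 := \int[product_law (fun i => P (lift ord0 i))]_y f (tuple_cons (y0, y)).
pose G y0 := \int[product_law (fun i => Q (lift ord0 i))]_y g (tuple_cons (y0, y)).
have mcons (h : n.+1.-tuple Y -> \bar R) y0 : measurable_fun setT h ->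
    measurable_fun setT (fun y => h (tuple_cons (y0, y))).
  move=> mh; apply: (@measurableT_comp _ _ _ _ _ _ h _ _ mh).
  rewrite /tuple_cons/=.
  exact: (@measurable_cons _ _ _ _ (fun=> y0) _ id).
have mF : measurable_fun setT F.
  apply: (@measurable_fun_fubini_tonelli_F _ _ _ _ _ _ (f \o @tuple_cons _ _ _)) => [|x].
    exact: measurableT_comp.
  exact: fge0.
have mG : measurable_fun setT G.
  apply: (@measurable_fun_fubini_tonelli_F _ _ _ _ _ _ (g \o @tuple_cons _ _ _)) => [|x].
    exact: measurableT_comp.
  exact: gge0.
have cF y : c%:E <= F y by apply: integral_ge_cst => //; exact: mcons.
have cG y : c%:E <= G y by apply: integral_ge_cst => //; exact: mcons.
have F0 y : 0 <= F y by apply: le_trans (cF y); rewrite lee_fin ltW.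
have sFG y : s%:E <= F y * G y.
  by apply: (IHn _ _ _ _ _ c) => //; exact: mcons.
have : (r ord0)%:E <= (\int[P ord0]_y (s^-1%:E * F y)) * (\int[Q ord0]_y G y).
  apply: (PQ ord0 (Num.min c (s^-1 * c))%R (fun y => s^-1%:E * F y) G) => //.
  - by rewrite lt_min c0 mulr_gt0// invr_gt0.
  - exact: measurable_funeM.
  - move=> y; apply: (@le_trans _ _ (s^-1%:E * c%:E)).
      by rewrite lee_fin ge_min lexx orbT.
    by rewrite lee_pmul2l// ?lte_fin ?invr_gt0.
  - by move=> y; apply: le_trans (cG y); rewrite lee_fin ge_min lexx.
  - move=> y; rewrite -muleA -(lee_pmul2l (x := s%:E))// ?lte_fin//.
    by rewrite mule1 muleA -EFinM mulfV ?gt_eqF// mul1e.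
rewrite ge0_integralZl//; last by rewrite lee_fin invr_ge0 ltW.
rewrite -(lee_pmul2l (x := s%:E))// ?lte_fin//.
by rewrite !muleA -!EFinM mulfV ?gt_eqF// mul1e mulrC.
Qed.

Lemma integral_two_valued {d : measure_display} {Y : measurableType d}
    (P : probability Y R) (D : set Y) (b c : R) :
  measurable D -> (0 <= b)%R -> (0 <= c)%R ->
  \int[P]_y (if y \in D then b else c)%:E = b%:E * P D + c%:E * (1 - P D).
Proof.
move=> mD b0 c0; have mDC : measurable (~` D) by exact: measurableC.
have m1 (A : set Y) : measurable A ->
    measurable_fun setT (fun y => (\1_A y)%:E : \bar R).
  by move=> mA; apply/measurable_EFinP; exact: measurable_indic.
transitivity (\int[P]_y (b%:E * (\1_D y)%:E + c%:E * (\1_(~` D) y)%:E)).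
  apply: eq_integral => y _; rewrite !indicE in_setC; case: (y \in D) => /=.
    by rewrite mule1 mule0 adde0.
  by rewrite mule1 mule0 add0e.
rewrite ge0_integralD//=; [|by move=> y _; rewrite mule_ge0// lee_fin
  |exact/measurable_funeM/m1|by move=> y _; rewrite mule_ge0// lee_fin
  |exact/measurable_funeM/m1].
rewrite !ge0_integralZl//=; try by [exact: m1|move=> y _; rewrite lee_fin].
by rewrite !integral_indic// !setIT -probability_setC.
Qed.

(** The test function for [P] is [a] on [D] and [a^-1] off [D], and its reciprocal is used for [Q].
    The error bounds make each integral at most [a + a^-1 * a ^ 2 = 2 * a]. *)
Lemma affinity_ge_test {d : measure_display} {Y : measurableType d}
    (P Q : probability Y R) (r a : R) (D : set Y) :
  (0 < a <= 1)%R -> affinity_ge P Q r -> measurable D ->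
  (1 - a ^+ 2)%:E <= P D -> Q D <= (a ^+ 2)%:E -> (r <= 4 * a ^+ 2)%R.
Proof.
move=> /andP[a0 a1] PQ mD PD QD.
pose h (b c : R) y := (if y \in D then b else c)%:E.
have mh b c : measurable_fun setT (h b c).
  apply/measurable_EFinP; apply: measurable_fun_if => //=.
  by apply: (measurable_fun_bool true); rewrite setTI preimage_mem_true.
have ai : (a <= a^-1)%R by rewrite (le_trans a1)// invf_ge1.
have := PQ a (h a a^-1%R) (h a^-1%R a) a0 (mh _ _) (mh _ _).
have h1 y : a%:E <= h a a^-1%R y by rewrite lee_fin; case: ifP.
have h2 y : a%:E <= h a^-1%R a y by rewrite lee_fin; case: ifP.
have h3 y : 1 <= h a a^-1%R y * h a^-1%R a y.
  by rewrite -EFinM lee_fin; case: ifP; rewrite (mulVf,mulfV)// gt_eqF.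
move=> /(_ h1 h2 h3); rewrite !integral_two_valued ?invr_ge0 ?(ltW a0)//.
have fP : P D \is a fin_num by rewrite fin_num_measure.
have fQ : Q D \is a fin_num by rewrite fin_num_measure.
have : (fine (P D) <= 1)%R by rewrite -lee_fin fineK// probability_le1.
have : (0 <= fine (Q D))%R by rewrite fine_ge0.
move: PD QD; rewrite -(fineK fP) -(fineK fQ) !lee_fin => PD QD Q0 P1.
move=> /le_trans; apply.
move: (fine (P D)) (fine (Q D)) PD QD Q0 P1 => p q PD QD /= Q0 P1.
have -> : (4 * a ^+ 2 = (a + a) * (a + a))%R by ring.
have a2 : (a^-1 * a ^+ 2 = a)%R by rewrite expr2 mulrA mulVf ?mul1r// gt_eqF.
have ai0 : (0 <= a^-1)%R by rewrite invr_ge0 ltW.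
apply: ler_pM; last 2 first.
- by apply: lerD; [rewrite ler_piMr// ltW|rewrite -[leRHS]a2 ler_wpM2l//; lra].
- by apply: lerD; [rewrite -[leRHS]a2 ler_wpM2l|rewrite ler_piMr ?(ltW a0)//; lra].
- by rewrite addr_ge0// mulr_ge0 ?(ltW a0)// ?subr_ge0//; nra.
- by rewrite addr_ge0// mulr_ge0 ?(ltW a0)//; nra.
Qed.

End affinity.

(** * Upper bound from a quantization of the inputs *)

Section converse.
Context {R : realType} {X : Type} {d : measure_display} {Y : measurableType d}.
Variables (W : X -> probability Y R) (K : input_constraint (X := X)).

(** [phi] sends an input block to its cell. Only the cells in [S] are counted, because under an
    average constraint the product type [T] is much larger than the set of cells that admissible
    blocks reach. *)
Definition rate_half_quantization := forall e : R, 0 < e ->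
  \forall n \near \oo, exists (T : finType) (phi : n.-tuple X -> T) (S : {pred T}),
    [/\ forall u, K u -> phi u \in S,
        ln #|S|%:R <= (2^-1 + e) * (n%:R * ln n%:R)
      & forall u v, K u -> K v -> phi u = phi v ->
          affinity_ge (memoryless W u) (memoryless W v) 2^-1].

(** At a rate above [1 / 2] there are eventually more codewords than cells, so two codewords share a
    cell. Their output laws have affinity at least [1 / 2], whereas errors below [1 / 9] force at
    most [4 / 9], by [affinity_ge_test] with [a = 1 / 3]. *)
Lemma linearithmic_DI_capacity_le :
  rate_half_quantization -> (linearithmic_DI_capacity W K <= (2^-1)%:E)%E.
Proof.
move=> quant; apply: ge_ereal_sup => _ [r [r0 [N [l1 [l2 [code l10 l20 Nr]]]]] <-].
rewrite lee_fin leNgt; apply/negP => r2.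
pose e := (r - 2^-1) / 2.
have e0 : 0 < e by rewrite /e; lra.
have ninth : (0 : R) < 9^-1 by rewrite invr_gt0.
have [n [n2 [l1n [l2n [Nn [T [phi [S [phiS cardS aff]]]]]]]]] : exists n,
    [/\ (2 <= n)%N, l1 n < 9^-1, l2 n < 9^-1,
        2^-1 + e < ln (N n)%:R / (n%:R * ln n%:R)
      & exists (T : finType) (phi : n.-tuple X -> T) (S : {pred T}),
    [/\ forall u, K u -> phi u \in S,
        ln #|S|%:R <= (2^-1 + e) * (n%:R * ln n%:R)
      & forall u v, K u -> K v -> phi u = phi v ->
          affinity_ge (memoryless W u) (memoryless W v) 2^-1]].
  near \oo => n; exists n; split.
  - by near: n; exact: nbhs_infty_ge.
  - by near: n; exact: (cvgr_lt (0 : R)).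
  - by near: n; exact: (cvgr_lt (0 : R)).
  - by near: n; apply: (cvgr_gt r) => //; rewrite /e; lra.
  - by near: n; exact: quant.
have nln0 : 0 < n%:R * ln n%:R :> R.
  by rewrite mulr_gt0// ?ltr0n ?(ltnW n2)// ln_gt0// ltr1n.
have [u [D [Ku mD uD]]] := code n.
pose f i := phi (u i).
have [/injectiveP finj|/injectivePn[i [j ij fij]]] := boolP (injectiveb f).
  have NS : (N n <= #|S|)%N.
    rewrite -[X in (X <= _)%N]size_enum_ord -(size_map f) cardE.
    apply: uniq_leq_size; first by rewrite map_inj_uniq ?enum_uniq.
    by move=> _ /mapP[i _ ->]; rewrite mem_enum; exact: phiS.
  (* As [ln 0 = 0], an empty code has ratio [0], which [Nn] excludes. *)
  have [N0|N0] := posnP (N n).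
    by move: Nn; rewrite N0 ln0// mul0r; lra.
  have : ln (N n)%:R <= ln #|S|%:R :> R.
    by rewrite ler_ln ?posrE ?ltr0n ?ler_nat// (leq_trans N0).
  by move=> /le_trans/(_ cardS); rewrite -ler_pdivrMr// leNgt Nn.
have ji : j != i by rewrite eq_sym.
have := affinity_ge_test (a := 3^-1) _ (aff _ _ (Ku i) (Ku j) fij) (mD i).
have [+ _] := uD i j ij; have [_ +] := uD j i ji.
rewrite invr_gt0 ltr0n invf_le1 ?ltr0n// ler1n => Dj Di /(_ isT).
have -> : 3^-1 ^+ 2 = 9^-1 :> R by rewrite exprVn -natrX.
move=> test; suff : 2^-1 <= 4 * 9^-1 :> R by lra.
apply: test.
  by apply: le_trans Di; rewrite lee_fin lerB// ltW.
by apply: (le_trans Dj); rewrite lee_fin ltW.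
Unshelve. all: by end_near.
Qed.

End converse.

(** * Affinity from the arithmetic-geometric mean inequality and from Hellinger distance *)

Section affinity_lower_bounds.
Context {R : realType}.
Local Open Scope ereal_scope.

Lemma ge0_amgm (a b s : R) :
  (0 <= a -> 0 <= b -> 0 <= s -> s ^+ 2 <= a * b -> s + s <= a + b)%R.
Proof.
move=> a0 b0 s0 sab; rewrite -ler_sqr ?nnegrE ?addr_ge0//.
have := sqr_ge0 (a - b)%R; nra.
Qed.

Lemma ereal_amgm (p q : R) (f g : \bar R) : (0 <= p)%R -> (0 <= q)%R ->
    0 <= f -> 0 <= g -> 1 <= f * g ->
  (Num.sqrt (p * q))%:E + (Num.sqrt (p * q))%:E <= f * p%:E + g * q%:E.
Proof.
move=> p0 q0 f0 g0 fg.
have [p0'|p_neq0] := eqVneq p 0%R.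
  by rewrite p0' mul0r sqrtr0 !adde0 adde_ge0// mule_ge0.
have [q0'|q_neq0] := eqVneq q 0%R.
  by rewrite q0' mulr0 sqrtr0 !adde0 adde_ge0// mule_ge0.
have pgt0 : (0 < p)%R by rewrite lt_neqAle eq_sym p_neq0.
have qgt0 : (0 < q)%R by rewrite lt_neqAle eq_sym q_neq0.
case: f g f0 g0 fg => [f| |] [g| |] //= f0 g0 fg.
- rewrite -!EFinM -!EFinD lee_fin; apply: ge0_amgm.
  + by rewrite mulr_ge0.
  + by rewrite mulr_ge0.
  + exact: sqrtr_ge0.
  + rewrite sqr_sqrtr ?mulr_ge0//.
    rewrite (_ : (f * p * (g * q) = (f * g) * (p * q))%R); last by ring.
    by rewrite ler_peMl ?mulr_ge0// -lee_fin.
- by rewrite gt0_mulye ?lte_fin// -EFinM addey// leey.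
- by rewrite gt0_mulye ?lte_fin// addye// leey.
- by rewrite !gt0_mulye ?lte_fin// leey.
Qed.

(** The additive inequality is applied to the rescaled pair [t f], [t^-1 g], whose product is still
    at least [1]. The choice [t = k / \int f] makes the first term equal to [k] and leaves
    [k ^ 2 <= (\int f) (\int g)]. *)
Lemma affinity_ge_amgm {d : measure_display} {Y : measurableType d}
    (P Q : probability Y R) (k : R) : (0 < k)%R ->
  (forall f g : Y -> \bar R, measurable_fun setT f -> measurable_fun setT g ->
    (forall y, 0 <= f y) -> (forall y, 0 <= g y) -> (forall y, 1 <= f y * g y) ->
    k%:E + k%:E <= \int[P]_y f y + \int[Q]_y g y) ->
  affinity_ge P Q (k ^+ 2).
Proof.
move=> k0 H c f g c0 mf mg cf cg fg.
have f0 y : 0 <= f y by apply: le_trans (cf y); rewrite lee_fin ltW.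
have g0 y : 0 <= g y by apply: le_trans (cg y); rewrite lee_fin ltW.
have cF : c%:E <= \int[P]_y f y by exact: integral_ge_cst.
have cG : c%:E <= \int[Q]_y g y by exact: integral_ge_cst.
have F0 : 0 < \int[P]_y f y by apply: lt_le_trans cF; rewrite lte_fin.
have G0 : 0 < \int[Q]_y g y by apply: lt_le_trans cG; rewrite lte_fin.
have tH (t : R) : (0 < t)%R ->
    k%:E + k%:E <= t%:E * \int[P]_y f y + t^-1%:E * \int[Q]_y g y.
  move=> t0; have ti0 : (0 < t^-1)%R by rewrite invr_gt0.
  rewrite -!ge0_integralZl// ?lee_fin ?(ltW t0) ?(ltW ti0)//; apply: H.
  - exact: measurable_funeM.
  - exact: measurable_funeM.
  - by move=> y; rewrite mule_ge0// lee_fin ltW.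
  - by move=> y; rewrite mule_ge0// lee_fin ltW.
  - by move=> y; rewrite muleACA -EFinM mulfV ?gt_eqF// mul1e.
case: (\int[P]_y f y) (\int[Q]_y g y) F0 G0 tH {cF cG} => [F| |] [G| |] //=;
  last 3 first.
- by move=> F0 _ _; rewrite gt0_muley// leey.
- by move=> _ G0 _; rewrite gt0_mulye// leey.
- by move=> _ _ _; rewrite mulyy leey.
rewrite !lte_fin => F0 G0 /(_ (k / F)%R).
rewrite divr_gt0// => /(_ isT); rewrite -!EFinM -!EFinD !lee_fin.
by rewrite divfK ?gt_eqF// invf_div lerD2l -mulrAC ler_pdivlMr.
Qed.

Lemma ge0_integral_discrete {d : measure_display} {Y : measurableType d}
    (P : probability Y R) (f : Y -> \bar R) : discrete_alphabet Y ->
  (forall y, 0 <= f y) -> \int[P]_y f y = \esum_(y in setT) f y * P [set y].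
Proof.
move=> [/countable_injP[e inj_e] mY] f0.
have mf A : measurable_fun A f by move=> _ B _; exact: mY.
pose F n := e @^-1` [set n].
have FT : \bigcup_n F n = setT by apply/seteqP; split => // y _; exists (e y).
have trivF : trivIset setT F by exact: trivIset_preimage1.
rewrite -FT ge0_integral_bigcup// nneseries_sum_bigcup//; last first.
  by move=> y; rewrite mule_ge0.
apply: eq_eseriesr => n _.
have [[y yn]|nFn] := pselect (exists y, e y = n); last first.
  have -> : F n = set0.
    by apply/seteqP; split => // y Fy; apply: nFn; exists y.
  by rewrite integral_set0 esum_set0.
have -> : F n = [set y].
  by apply/seteqP; split => [z zn|_ ->//]; apply: inj_e; rewrite ?inE// yn.
rewrite esum_set1 ?mule_ge0// (eq_integral (cst (f y))); last first.
  by move=> z; rewrite inE => ->.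
by rewrite integral_cst.
Qed.

Lemma affinity_ge_discrete {d : measure_display} {Y : measurableType d}
    (P Q : probability Y R) (k : R) : discrete_alphabet Y -> (0 < k)%R ->
  k%:E <= \esum_(y in setT)
    (Num.sqrt (fine (P [set y]) * fine (Q [set y])))%:E ->
  affinity_ge P Q (k ^+ 2).
Proof.
move=> dY k0 kPQ; apply: affinity_ge_amgm => // f g mf mg f0 g0 fg.
rewrite !ge0_integral_discrete// -esumD; last 2 first.
- by move=> y _; rewrite mule_ge0.
- by move=> y _; rewrite mule_ge0.
apply: le_trans (leeD kPQ kPQ) _; rewrite -esumD; last 2 first.
- by move=> y _; rewrite lee_fin.
- by move=> y _; rewrite lee_fin.
apply: le_esum => y _.
have mset1 : measurable [set y] by exact: dY.2.
apply: le_trans (ereal_amgm (fine_ge0 (measure_ge0 P [set y]))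
  (fine_ge0 (measure_ge0 Q [set y])) (f0 y) (g0 y) (fg y)) _.
by rewrite !fineK ?fin_num_measure.
Qed.

Lemma esum_probability {d : measure_display} {Y : measurableType d}
    (P : probability Y R) : discrete_alphabet Y ->
  \esum_(y in setT) P [set y] = 1.
Proof.
move=> dY; have <- : \int[P]_y 1 = 1.
  by rewrite integral_cst//= probability_setT mule1.
by rewrite ge0_integral_discrete//; apply: eq_esum => y _; rewrite mul1e.
Qed.

(** Expand the square and use that each law sums to [1]. The identity has no subtraction because the
    finiteness of both sums is deduced from it. *)
Lemma esum_hellinger_affinity {d : measure_display} {Y : measurableType d}
    (P Q : probability Y R) : discrete_alphabet Y ->
  let p y := fine (P [set y]) in let q y := fine (Q [set y]) in
  let B := \esum_(y in setT) (Num.sqrt (p y * q y))%:E in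
  \esum_(y in setT) ((Num.sqrt (p y) - Num.sqrt (q y)) ^+ 2)%:E + (B + B) = 1 + 1.
Proof.
move=> dY p q B.
have p0 y : (0 <= p y)%R by rewrite fine_ge0.
have q0 y : (0 <= q y)%R by rewrite fine_ge0.
transitivity (\esum_(y in setT) P [set y] + \esum_(y in setT) Q [set y]);
  last by rewrite !esum_probability.
rewrite -!esumD//; try by move=> y _; rewrite ?adde_ge0// lee_fin ?sqr_ge0.
apply: eq_esum => y _.
have mset1 : measurable [set y] by exact: dY.2.
rewrite -[in RHS](fineK (fin_num_measure P _ mset1)).
rewrite -[in RHS](fineK (fin_num_measure Q _ mset1)).
rewrite -!EFinD; congr EFin; rewrite -/(p y) -/(q y).
rewrite sqrtrM// -[in RHS](sqr_sqrtr (p0 y)) -[in RHS](sqr_sqrtr (q0 y)); ring.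
Qed.

(** [hellinger] is defined through [fine], which would send an infinite sum to [0]; the preceding
    identity bounds the sum by [2]. *)
Lemma hellinger_sqr {d : measure_display} {Y : measurableType d}
    (P Q : probability Y R) : discrete_alphabet Y ->
  (hellinger P Q ^+ 2)%:E = \esum_(y in setT)
    ((Num.sqrt (fine (P [set y])) - Num.sqrt (fine (Q [set y]))) ^+ 2)%:E.
Proof.
move=> dY; set H := \esum_(y in _) _.
have H0 : 0 <= H by apply: esum_ge0 => y _; rewrite lee_fin sqr_ge0.
rewrite sqr_sqrtr ?fine_ge0// fineK// ge0_fin_numE//.
apply: (@le_lt_trans _ _ (1 + 1)); last by rewrite -EFinD ltry.
rewrite -(esum_hellinger_affinity P Q dY) leeDl// adde_ge0//;
  by apply: esum_ge0 => y _; rewrite lee_fin.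
Qed.

Lemma affinity_ge_hellinger {d : measure_display} {Y : measurableType d}
    (P Q : probability Y R) : discrete_alphabet Y -> (hellinger P Q ^+ 2 < 2)%R ->
  affinity_ge P Q ((1 - hellinger P Q ^+ 2 / 2) ^+ 2).
Proof.
move=> dY h2; apply: affinity_ge_discrete => //; first by lra.
have := esum_hellinger_affinity P Q dY; rewrite /= -hellinger_sqr//.
case: (\esum_(y in _) _) => [B| |] //; rewrite -!EFinD => -[] hB.
by rewrite lee_fin; lra.
Qed.

Lemma hellinger_triangle {d : measure_display} {Y : measurableType d}
    (S P Q : probability Y R) : discrete_alphabet Y ->
  (hellinger P Q ^+ 2 <= 2 * hellinger S P ^+ 2 + 2 * hellinger S Q ^+ 2)%R.
Proof.
move=> dY.
have -> : (2 * hellinger S P ^+ 2 + 2 * hellinger S Q ^+ 2 =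
  hellinger S P ^+ 2 + hellinger S P ^+ 2 +
  (hellinger S Q ^+ 2 + hellinger S Q ^+ 2))%R by ring.
rewrite -lee_fin !EFinD !hellinger_sqr// -!esumD//;
  try by move=> y _; rewrite ?adde_ge0// lee_fin ?sqr_ge0.
apply: le_esum => y _; rewrite -!EFinD lee_fin.
set p := Num.sqrt _; set q := Num.sqrt _; set s := Num.sqrt _.
have := sqr_ge0 (s - p + (s - q))%R; nra.
Qed.

End affinity_lower_bounds.

(** * Quantization of each letter at scale [1 / sqrt n] *)

Lemma affinity_ge_le {R : realType} {d : measure_display} {Y : measurableType d}
    (P Q : probability Y R) (r s : R) :
  r <= s -> affinity_ge P Q s -> affinity_ge P Q r.
Proof.
move=> rs PQ c f g c0 mf mg cf cg fg.
by apply: le_trans (PQ c f g c0 mf mg cf cg fg); rewrite lee_fin.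
Qed.

Lemma bernoulli_inequality {R : realDomainType} (x : R) (n : nat) :
  0 <= x <= 1 -> 1 - n%:R * x <= (1 - x) ^+ n.
Proof.
move=> /andP[x0 x1]; elim: n => [|n IHn]; first by rewrite mul0r subr0 expr0.
rewrite exprS; apply: (@le_trans _ _ ((1 - x) * (1 - n%:R * x))).
  rewrite -natr1; have : 0 <= n%:R * x * x by rewrite !mulr_ge0.
  nra.
by rewrite ler_wpM2l// subr_ge0.
Qed.

(** Bernoulli's inequality at [x = (2 * n)^-1] gives [(1 - x) ^ n >= 1 - n * x = 1 / 2]. This makes
    squared distances of order [1 / n] per letter the right scale. *)
Lemma affinity_ge_memoryless {R : realType} {X : Type} {d : measure_display}
    {Y : measurableType d} (W : X -> probability Y R) (n : nat)
    (u v : n.-tuple X) :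
  (forall i, affinity_ge (W (tnth u i)) (W (tnth v i)) (1 - (2 * n%:R)^-1)) ->
  affinity_ge (memoryless W u) (memoryless W v) 2^-1.
Proof.
case: n u v => [|n] u v uv.
  apply: (@affinity_ge_le _ _ _ _ _ _ (\prod_(i < 0) 1)).
    by rewrite big_ord0 invf_le1// ler1n.
  by apply: affinity_ge_product => -[].
have n2 : 2 <= 2 * n.+1%:R :> R by rewrite ler_peMr// ler1n.
have n0 : 0 < (2 * n.+1%:R)^-1 :> R by rewrite invr_gt0; lra.
have n1 : (2 * n.+1%:R)^-1 <= 2^-1 :> R by rewrite lef_pV2// posrE; lra.
apply: affinity_ge_le; last by apply: (affinity_ge_product _ uv) => _; rewrite subr_gt0 (le_lt_trans n1)// invf_lt1// ltr1n.
rewrite big_const_ord iter_mulr_1.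
apply: le_trans (bernoulli_inequality _ _); last first.
  by rewrite (ltW n0) (le_trans n1)// invf_le1// ler1n.
by rewrite invfM mulrCA mulfV ?pnatr_eq0// mulr1; lra.
Qed.

Lemma near_le_mul_ln {R : realType} (C e : R) : 0 < e ->
  \forall n \near \oo, C <= e * ln (n%:R : R).
Proof.
move=> e0; near=> n; rewrite mulrC -ler_pdivrMr// -[leLHS]expRK ler_ln.
- by apply: ltW; near: n; exact: nbhs_infty_gtr.
- by rewrite posrE expR_gt0.
- by rewrite posrE ltr0n; near: n; exact: nbhs_infty_gt.
Unshelve. all: by end_near.
Qed.

(** Each letter is rounded to the centre of a covering ball of radius [eps]. Dimension [1] allows
    fewer than [eps^-1] to the power [1 + e] balls, that is [n ^ ((1 + e) / 2)] up to a constant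
    factor. *)
Lemma rate_half_quantization_dim1 {R : realType} {X : Type}
    {d : measure_display} {Y : measurableType d} (W : X -> probability Y R)
    (K : input_constraint (X := X)) :
  discrete_alphabet Y -> has_minkowski_dim (channel_image W) 1 ->
  rate_half_quantization W K.
Proof.
move=> dY dim1 e e0.
have : \forall eps \near (0 : R)^'+,
    (entropy_ratio (channel_image W) eps < (1 + e)%:E)%E.
  apply: (dim1 [set x | (x < (1 + e)%:E)%E]); apply: open_ereal_lt'.
  by rewrite lte_fin; lra.
move=> [del /= del0 Hdel].
near=> n.
have n0 : 0 < n%:R :> R by rewrite ltr0n; near: n; exact: nbhs_infty_gt.
have n8 : 0 <= 8 * n%:R :> R by rewrite mulr_ge0 ?ler0n.
(* With [eps ^ 2 = 1 / (8 n)], two laws in one ball have squared distance [h] at most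
   [4 * eps ^ 2 = 1 / (2 n)], and their affinity is at least [(1 - h / 2) ^ 2 >= 1 - h]. *)
pose eps : R := (Num.sqrt (8 * n%:R))^-1.
have s0 : 0 < Num.sqrt (8 * n%:R) :> R by rewrite sqrtr_gt0 mulr_gt0.
have eps0 : 0 < eps by rewrite invr_gt0.
have eps2 : eps ^+ 2 = (8 * n%:R)^-1.
  by rewrite exprVn sqr_sqrtr.
have epsdel : eps < del.
  rewrite -[ltRHS]invrK ltf_pV2 ?posrE ?invr_gt0//.
  rewrite -(ltr_pXn2r (n := 2)) ?nnegrE ?invr_ge0 ?(ltW s0) ?(ltW del0)//.
  rewrite sqr_sqrtr//; apply: (@lt_le_trans _ _ n%:R); last first.
    by rewrite ler_peMl// ?ler0n// ler1n.
  by near: n; exact: nbhs_infty_gtr.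
pose L : R := ln eps^-1.
have LE : L = 2^-1 * (ln 8 + ln n%:R).
  have : ln ((eps^-1) ^+ 2) = ln (8 * n%:R) :> R.
    by rewrite exprVn eps2 invrK.
  rewrite lnXn ?invr_gt0// lnM ?posrE// -/L => <-.
  by rewrite mulrnAr -mulr_natl mulrA; lra.
have lnn0 : 0 < ln n%:R :> R.
  by rewrite ln_gt0// ltr1n; near: n; exact: nbhs_infty_gt.
have ln80 : 0 < ln 8 :> R by rewrite ln_gt0// ltr1n.
have L0 : 0 < L by rewrite LE; lra.
have : (covering_number (channel_image W) eps < (expR ((1 + e) * L))%:E)%E.
  have : (entropy_ratio (channel_image W) eps < (1 + e)%:E)%E.
    by apply: Hdel => //; rewrite /ball/= sub0r normrN gtr0_norm.
  rewrite /entropy_ratio -/L => H.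
  have {H} : (lne (covering_number (channel_image W) eps) < ((1 + e) * L)%:E)%E.
    by move: H; rewrite -lte_pdivlMr ?invr_gt0// invrK -EFinM.
  rewrite -lte_expeR /= lneK// in_itv/= leey andbT.
  by apply: le_ereal_inf_tmp => _ [N _ <-]; rewrite lee_fin.
move=> /ereal_inf_lt[_ [M [c cM] <-]]; rewrite lte_fin => Mexp.
have WM x : exists i, hellinger (c i) (W x) < eps by apply: cM; exists x.
pose code x := sval (cid (WM x)).
have codeP x : hellinger (c (code x)) (W x) < eps := svalP (cid (WM x)).
exists {ffun 'I_n -> 'I_M}, (fun u => [ffun i => code (tnth u i)]), predT.
split => // [|u v _ _ /ffunP uv].
  rewrite card_ffun !card_ord natrX.
  have lnM : ln M%:R <= (1 + e) * L.
    have [->|M0] := posnP M; first by rewrite ln0// mulr_ge0 ?(ltW L0)//; lra.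
    by rewrite -[leRHS]expRK ler_ln ?posrE ?ltr0n ?expR_gt0// ltW.
  apply: (@le_trans _ _ (n%:R * ln M%:R)).
    have [->|M0] := posnP M.
      rewrite expr0n -[(n == 0)%N]negbK -lt0n -(ltr0n R) n0/=.
      by rewrite !ln0// mulr0.
    by rewrite lnXn ?ltr0n// mulr_natl.
  rewrite mulrCA ler_wpM2l ?(ltW n0)//; apply: (le_trans lnM); rewrite LE.
  have : 2^-1 * (1 + e) * ln 8 <= 2^-1 * e * ln (n%:R : R).
    by near: n; apply: near_le_mul_ln; lra.
  lra.
apply: affinity_ge_memoryless => i.
have h2 : hellinger (W (tnth u i)) (W (tnth v i)) ^+ 2 <= (2 * n%:R)^-1.
  apply: (le_trans (hellinger_triangle (c (code (tnth u i))) _ _ dY)).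
  have h0 (p q : probability Y R) : 0 <= hellinger p q by exact: sqrtr_ge0.
  have hu : hellinger (c (code (tnth u i))) (W (tnth u i)) ^+ 2 <= eps ^+ 2.
    by rewrite ler_sqr ?nnegrE ?h0 ?(ltW eps0)// ltW.
  have hv : hellinger (c (code (tnth u i))) (W (tnth v i)) ^+ 2 <= eps ^+ 2.
    have /= := uv i; rewrite !ffunE => ->.
    by rewrite ler_sqr ?nnegrE ?h0 ?(ltW eps0)// ltW.
  have -> : (2 * n%:R)^-1 = 2 * eps ^+ 2 + 2 * eps ^+ 2 :> R.
    by rewrite eps2 !invfM; lra.
  lra.
have n2 : (2 * n%:R)^-1 <= 2^-1 :> R.
  rewrite lef_pV2 ?posrE ?mulr_gt0// ler_peMr// ler1n -(ltr0n R); exact: n0.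
have h0 := sqr_ge0 (hellinger (W (tnth u i)) (W (tnth v i))).
apply: affinity_ge_le (affinity_ge_hellinger dY _); last by lra.
move: (hellinger _ _ ^+ 2) h2 h0 => h h2 h0; nra.
Unshelve. all: by end_near.
Qed.

Lemma ffact_le_expn (n m : nat) : (n ^_ m <= n ^ m)%N.
Proof. by elim: m => // m IHm; rewrite ffactnSr expnSr leq_mul ?leq_subr. Qed.

(** The ratio [n ^ n * exp (- n) / n!] is the probability that a Poisson variable of mean [n] equals
    [n], hence at most [1]. *)
Lemma natX_le_fact_expR {R : realType} (n : nat) :
  n%:R ^+ n <= n`!%:R * expR n%:R :> R.
Proof.
have f0 : 0 < n`!%:R :> R by rewrite ltr0n fact_gt0.
have : (poisson_channel (NngNum (ler0n R n)) [set n] <= 1)%E.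
  exact: probability_le1.
rewrite poisson_channelE /= lee_fin expRN.
by rewrite ler_pdivrMr// mul1r mulrC ler_pdivrMr// expR_gt0.
Qed.

(** From ['C(n + M, n) <= (n + M) ^ n / n!] and [n ^ n <= n! * e ^ n], the binomial coefficient is
    at most [(e * a) ^ n]. *)
Lemma ln_binomial_le {R : realType} (n M : nat) (a : R) :
  (0 < n)%N -> 0 < a -> (n + M)%:R <= a * n%:R ->
  ln 'C(n + M, n)%:R <= n%:R * (1 + ln a).
Proof.
move=> n0 a0 nMa.
have n0' : 0 < n%:R :> R by rewrite ltr0n.
have C0 : 0 < 'C(n + M, n)%:R :> R by rewrite ltr0n bin_gt0 leq_addr.
have -> : n%:R * (1 + ln a) = ln ((expR 1 * a) ^+ n) :> R.
  by rewrite lnXn ?mulr_gt0 ?expR_gt0// lnM ?posrE ?expR_gt0// expRK mulr_natl.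
rewrite ler_ln ?posrE ?exprn_gt0 ?mulr_gt0 ?expR_gt0//.
rewrite -(ler_pM2r (exprn_gt0 n n0')) -exprMn.
apply: (@le_trans _ _ ('C(n + M, n)%:R * (n`!%:R * expR n%:R))).
  by rewrite ler_wpM2l ?natX_le_fact_expR// ltW.
rewrite mulrA -natrM bin_ffact (_ : expR n%:R = expR 1 ^+ n); last first.
  by rewrite -expRM_natl mulr1.
rewrite -mulrA exprMn mulrC ler_wpM2l ?exprn_ge0 ?expR_ge0//.
apply: (@le_trans _ _ ((n + M)%:R ^+ n)).
  by rewrite -natrX ler_nat ffact_le_expn.
by rewrite lerXn2r// nnegrE// mulr_ge0// ltW.
Qed.

Lemma truncn_eq_dist {R : archiRealFieldType} (a b : R) : 0 <= a -> 0 <= b ->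
  Num.truncn a = Num.truncn b -> `|a - b| < 1.
Proof.
move=> a0 b0 ab.
have /andP[a1 a2] := truncn_itv a0; have /andP[b1 b2] := truncn_itv b0.
by rewrite ab in a1 a2; rewrite -natr1 in a2 b2; rewrite ltr_norml; lra.
Qed.

(** The cell of a block records, for each letter, the sign of [z] and the integer part of
    [|z| * sqrt (2 n)]. The quadratic bound limits the sum of these integers to [O (n * sqrt n)], so
    the logarithm of the number of cells is [n / 2 * ln n + O (n)]. Letters in one cell have
    [(z x - z y) ^ 2 <= 1 / (2 n)], and [exp (- w) >= 1 - w]. *)
Lemma rate_half_quantization_embedding {R : realType} {X : Type}
    {d : measure_display} {Y : measurableType d} (W : X -> probability Y R)
    (K : input_constraint (X := X)) (z : X -> R) (B : R) :
  (forall x y, affinity_ge (W x) (W y) (expR (- (z x - z y) ^+ 2))) ->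
  (forall n (u : n.-tuple X), K n u -> \sum_(i < n) z (tnth u i) ^+ 2 <= n%:R * B) ->
  rate_half_quantization W K.
Proof.
move=> affz Kz e e0.
pose a : R := `|B| + 3.
have a0 : 0 < a by rewrite /a; have := normr_ge0 B; lra.
near=> n.
have n0 : (0 < n)%N by near: n; exact: nbhs_infty_gt.
have n0' : 0 < n%:R :> R by rewrite ltr0n.
pose s : R := Num.sqrt n%:R.
have s0 : 0 < s by rewrite sqrtr_gt0.
have s2 : s ^+ 2 = n%:R by rewrite sqr_sqrtr// ltW.
have s1 : 1 <= s by rewrite -ler_sqr ?nnegrE ?(ltW s0)// s2 expr1n ler1n.
pose M := Num.truncn (n%:R * s * (`|B| + 1)).
have B1 : 0 < `|B| + 1 by have := normr_ge0 B; lra.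
have Mle : M%:R <= n%:R * s * (`|B| + 1).
  by rewrite truncn_le !mulr_ge0// ltW.
pose t x : R := `|z x| * Num.sqrt (2 * n%:R).
have t0 x : 0 <= t x by rewrite mulr_ge0// sqrtr_ge0.
(* A completed square turns the quadratic constraint into a linear one:
   [sqrt 2 * |z| <= z ^ 2 / 2 + 1]. *)
have tle x : t x <= s * (z x ^+ 2 + 1).
  have -> : t x = s * (`|z x| * Num.sqrt 2).
    by rewrite /t sqrtrM// -/s; ring.
  rewrite ler_wpM2l ?(ltW s0)// -real_normK ?num_real//.
  have := sqr_ge0 (`|z x| - Num.sqrt 2).
  have : Num.sqrt 2 ^+ 2 = 2 :> R by rewrite sqr_sqrtr.
  by have := sqr_ge0 `|z x|; nra.
pose k (u : n.-tuple X) i := Num.truncn (t (tnth u i)).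
have sum_k u : K n u -> (\sum_(i < n) k u i <= M)%N.
  move=> Ku; rewrite -ltnS -(ltr_nat R); apply: le_lt_trans (truncnS_gt _).
  rewrite natr_sum; apply: (@le_trans _ _ (\sum_(i < n) s * (z (tnth u i) ^+ 2 + 1))).
    by apply: ler_sum => i _; apply: le_trans (tle _); rewrite truncn_le.
  rewrite -mulr_sumr big_split/= sumr_const card_ord -mulr_natl mulr1.
  rewrite (mulrC n%:R s) -mulrA ler_wpM2l ?(ltW s0)// mulrDr mulr1 lerD2r.
  by apply: (le_trans (Kz _ _ Ku)); rewrite ler_wpM2l ?ler_norm// ltW.
(* There are ['C(n + M, n)] vectors of [n] naturals with sum at most [M]. Their entries are at most
   [M], so [inord] alters no value coming from an admissible block. *)
pose A : {pred n.-tuple 'I_M.+1} := 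
  [pred v : n.-tuple 'I_M.+1 | (\sum_(i <- v) i <= M)%N].
pose S : {pred n.-tuple 'I_M.+1 * n.-tuple bool} := fun p => p.1 \in A.
exists (n.-tuple 'I_M.+1 * n.-tuple bool)%type,
  (fun u => ([tuple inord (k u i) | i < n], [tuple 0 <= z (tnth u i) | i < n])),
  S.
have kM u i : K n u -> (k u i < M.+1)%N.
  move=> /sum_k; rewrite ltnS; apply: leq_trans.
  by rewrite (bigD1 i)//= leq_addr.
split.
- move=> u Ku; rewrite /S unfold_in /= inE big_tuple.
  under eq_bigr do rewrite tnth_mktuple inordK ?kM//.
  exact: sum_k.
- have -> : #|S| = ('C(n + M, n) * 2 ^ n)%N.
    rewrite (@eq_card _ _ (predX A predT)); last first.
      by move=> p; rewrite !inE andbT.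
    rewrite cardX card_tuple card_bool -card_partial_ord_partitions.
    by congr (_ * _)%N; rewrite cardsE.
  rewrite natrM lnM ?posrE ?ltr0n ?expn_gt0 ?bin_gt0 ?leq_addr//.
  rewrite natrX lnXn// -[ln 2 *+ n]mulr_natl.
  apply: (@le_trans _ _ (n%:R * (1 + ln (a * s)) + n%:R * ln 2)).
    rewrite lerD2r; apply: ln_binomial_le => //; first by rewrite mulr_gt0.
    rewrite natrD; have : n%:R <= n%:R * s by rewrite ler_peMr.
    by rewrite /a; have : 0 <= n%:R * s; [by rewrite mulr_ge0// ltW|nra].
  rewrite -mulrDr mulrCA ler_wpM2l ?(ltW n0')//.
  have -> : ln (a * s) = ln a + 2^-1 * ln n%:R.
    by rewrite lnM ?posrE// -s2 lnXn// -[ln s *+ 2]mulr_natl; lra.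
  have : 1 + ln a + ln 2 <= e * ln (n%:R : R).
    by near: n; exact: near_le_mul_ln.
  lra.
- move=> u v Ku Kv uv.
  apply: affinity_ge_memoryless => i; apply: affinity_ge_le (affz _ _).
  apply: le_trans (expR_ge1Dx _); rewrite lerD2l lerN2.
  have sgn : (0 <= z (tnth u i)) = (0 <= z (tnth v i)).
    by have := congr1 (fun w => tnth w.2 i) uv; rewrite /= !tnth_mktuple.
  have kk : k u i = k v i.
    have := congr1 (fun w => nat_of_ord (tnth w.1 i)) uv.
    by rewrite /= !tnth_mktuple !inordK ?kM.
  have := truncn_eq_dist (t0 _) (t0 _) kk.
  rewrite -(ltr_pXn2r (n := 2)) ?nnegrE// expr1n real_normK ?num_real//.
  rewrite /t -mulrBl exprMn sqr_sqrtr ?mulr_ge0 ?(ltW n0')//.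
  have -> : (`|z (tnth u i)| - `|z (tnth v i)|) ^+ 2 =
      (z (tnth u i) - z (tnth v i)) ^+ 2.
    move: sgn; have [zu|zu] := leP 0 (z (tnth u i)) => /esym zv.
      by rewrite !ger0_norm.
    have zv0 : z (tnth v i) < 0 by rewrite ltNge zv.
    by rewrite (ltr0_norm zu) (ltr0_norm zv0); ring.
  by rewrite -ltr_pdivlMr ?mulr_gt0// mul1r => /ltW.
Unshelve. all: by end_near.
Qed.

(** * Affinity of Poisson laws *)

Section poisson_affinity.
Context {R : realType}.

(** With [a = sqrt x] and [b = sqrt y], the geometric mean of the two probability functions is [k]
    times that of the Poisson law of mean [a * b], so the Bhattacharyya sum is [k]. *)
Lemma affinity_ge_poisson (x y : {nonneg R}) :
  affinity_ge (poisson_channel x) (poisson_channel y)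
    (expR (- (Num.sqrt x%:num - Num.sqrt y%:num) ^+ 2)).
Proof.
set a := Num.sqrt x%:num; set b := Num.sqrt y%:num.
have a0 : 0 <= a by exact: sqrtr_ge0.
have b0 : 0 <= b by exact: sqrtr_ge0.
have ax : a ^+ 2 = x%:num by rewrite sqr_sqrtr.
have bx : b ^+ 2 = y%:num by rewrite sqr_sqrtr.
pose k := expR (- (a - b) ^+ 2 / 2).
have -> : expR (- (a - b) ^+ 2) = k ^+ 2.
  by rewrite -expRM_natl; congr expR; lra.
have dnat : discrete_alphabet nat by split; [exact: countableP|].
apply: affinity_ge_discrete => //; first exact: expR_gt0.
have ab0 : 0 <= a * b by rewrite mulr_ge0.
have <- : (\int[poisson_channel (NngNum ab0)]_j k%:E = k%:E)%E.
  by rewrite integral_cst//= probability_setT mule1.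
rewrite ge0_integral_discrete//; last by move=> _; rewrite lee_fin expR_ge0.
apply: le_esum => j _; rewrite !poisson_channelE /= -EFinM lee_fin -ax -bx.
have f0 : 0 < j`!%:R :> R by rewrite ltr0n fact_gt0.
have -> : expR (- a ^+ 2) * (a ^+ 2) ^+ j / j`!%:R *
    (expR (- b ^+ 2) * (b ^+ 2) ^+ j / j`!%:R) =
    (k * (expR (- (a * b)) * (a * b) ^+ j / j`!%:R)) ^+ 2.
  have -> : expR (- b ^+ 2) = (k * expR (- (a * b))) ^+ 2 * expR (a ^+ 2).
    by rewrite exprMn -!expRM_natl -!expRD; congr expR; rewrite !expr2; lra.
  have : expR (- a ^+ 2) * expR (a ^+ 2) = 1 by rewrite -expRD addNr expR0.
  rewrite !(exprAC _ 2 j) (exprMn j) => e1.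
  by rewrite -[RHS]mul1r -e1; ring.
by rewrite sqrtr_sqr ger0_norm// !mulr_ge0 ?expR_ge0// ?exprn_ge0.
Qed.

End poisson_affinity.

(** * Affinity of Gaussian laws *)

Section gaussian_affinity.
Context {R : realType}.
Local Open Scope ereal_scope.
Local Notation mu := (@lebesgue_measure R).

(** The Radon-Nikodym derivative of the normal law and [normal_pdf] have the same integral over
    every measurable set, hence agree almost everywhere. *)
Lemma ge0_integral_normal_prob (m s : R) (f : measurableTypeR R -> \bar R) :
  measurable_fun setT f -> (forall t, 0 <= f t) ->
  \int[normal_prob m s]_t f t = \int[mu]_t (f t * (normal_pdf m s t)%:E).
Proof.
move=> mf f0; have dom := normal_prob_dominates m s.
rewrite -(Radon_Nikodym_SigmaFinite.change_of_variables dom)//.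
have intd := Radon_Nikodym_SigmaFinite.f_integrable dom.
have mpdf : measurable_fun [set: measurableTypeR R] (EFin \o normal_pdf m s).
  by apply/measurable_EFinP; exact: measurable_normal_pdf.
apply: ge0_ae_eq_integral => //.
- by apply: emeasurable_funM => //; exact: measurable_int intd.
- exact: emeasurable_funM.
- by move=> t _; rewrite mule_ge0// Radon_Nikodym_SigmaFinite.f_ge0.
- by move=> t _; rewrite mule_ge0// lee_fin normal_pdf_ge0.
apply: ae_eqe_mul2l; apply: integral_ae_eq => // E _ mE.
by rewrite -Radon_Nikodym_SigmaFinite.f_integral.
Qed.

Lemma lebesgue_measure_additive (x : R) (A : set (measurableTypeR R)) :
  measurable A -> pushforward mu (Defs.additive x) A = mu A.
Proof.
move=> mA; apply/esym/lebesgue_measure_unique => //= _ [[a b]] _ <-.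
rewrite /pushforward (_ : Defs.additive x @^-1` _ = `]a - x, b - x]%classic)%R.
  rewrite !lebesgue_measure_itv/= !lte_fin ltrD2r -!EFinB.
  by rewrite opprB addrA subrK.
by apply/seteqP; split => t /=; rewrite !in_itv/= /Defs.additive; lra.
Qed.

Lemma ge0_integral_gaussian_channel (s x : R) (f : measurableTypeR R -> \bar R) :
  measurable_fun setT f -> (forall t, 0 <= f t) ->
  \int[gaussian_channel s x]_t f t =
  \int[mu]_t (f t * (normal_pdf 0 s (t - x)%R)%:E).
Proof.
move=> mf f0.
have mfa : measurable_fun setT (f \o Defs.additive x) by exact: measurableT_comp.
transitivity (\int[normal_prob 0 s]_t (f \o Defs.additive x) t).
  by rewrite ge0_integral_pushforward.
rewrite (ge0_integral_normal_prob 0 s mfa (fun t => f0 _)).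
pose h (t : measurableTypeR R) := f t * (normal_pdf 0 s (t - x)%R)%:E.
have mh : measurable_fun setT h.
  apply: emeasurable_funM => //; apply/measurable_EFinP.
  apply: (measurableT_comp (measurable_normal_pdf 0 s)).
  exact: measurable_funD.
have h0 t : 0 <= h t by rewrite mule_ge0// lee_fin normal_pdf_ge0.
transitivity (\int[pushforward mu (Defs.additive x)]_t h t); last first.
  by apply: eq_measure_integral => A mA _; exact: lebesgue_measure_additive.
transitivity (\int[mu]_t (h \o Defs.additive x) t); last first.
  by rewrite ge0_integral_pushforward.
by apply: eq_integral => t _; rewrite /= /h /Defs.additive addrAC subrr add0r.
Qed.

(** Completing the square, the geometric mean of the densities centred at [x] and [y] is [k] times
    the density centred at the midpoint [m], which integrates to [1]. *)
Lemma affinity_ge_gaussian (s x y : R) : (0 < s)%R ->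
  affinity_ge (gaussian_channel s x) (gaussian_channel s y)
    (expR (- (x / (2 * s) - y / (2 * s)) ^+ 2)).
Proof.
move=> s0; pose k : R := expR (- (x - y) ^+ 2 / (8 * s ^+ 2)).
have k0 : (0 < k)%R by exact: expR_gt0.
have sn0 : s != 0%R by rewrite gt_eqF.
have -> : expR (- (x / (2 * s) - y / (2 * s)) ^+ 2) = (k ^+ 2)%R.
  by rewrite -expRM_natl; congr expR; field.
apply: affinity_ge_amgm => // f g mf mg f0 g0 fg.
pose p z (t : measurableTypeR R) : R := normal_pdf 0 s (t - z).
have p0 z t : (0 <= p z t)%R by exact: normal_pdf_ge0.
have mp z : measurable_fun [set: measurableTypeR R] (fun t => (p z t)%:E).
  apply/measurable_EFinP; apply: (measurableT_comp (measurable_normal_pdf 0 s)).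
  exact: measurable_funD.
pose m : R := ((x + y) / 2)%R.
pose F (t : measurableTypeR R) := f t * (p x t)%:E.
pose G (t : measurableTypeR R) := g t * (p y t)%:E.
pose M (t : measurableTypeR R) := k%:E * (p m t)%:E.
have mF : measurable_fun [set: measurableTypeR R] F by exact: emeasurable_funM.
have mG : measurable_fun [set: measurableTypeR R] G by exact: emeasurable_funM.
have mM : measurable_fun [set: measurableTypeR R] M by exact: (measurable_funeM k%:E (mp m)).
have F0 t : 0 <= F t by apply: mule_ge0; rewrite ?lee_fin.
have G0 t : 0 <= G t by apply: mule_ge0; rewrite ?lee_fin.
have M0 t : 0 <= M t by apply: mule_ge0; rewrite lee_fin// ltW.
have -> : \int[gaussian_channel s x]_t f t = \int[mu]_t F t.
  exact: ge0_integral_gaussian_channel.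
have -> : \int[gaussian_channel s y]_t g t = \int[mu]_t G t.
  exact: ge0_integral_gaussian_channel.
have -> : k%:E = \int[mu]_t M t.
  rewrite -[LHS]mule1 -(probability_setT (gaussian_channel s m)).
  rewrite -integral_cst// ge0_integral_gaussian_channel// => t.
  by rewrite lee_fin ltW.
rewrite -(ge0_integralD _ measurableT (fun t _ => M0 t) mM (fun t _ => M0 t) mM).
rewrite -(ge0_integralD _ measurableT (fun t _ => F0 t) mF (fun t _ => G0 t) mG).
apply: ge0_le_integral.
- exact: measurableT.
- by move=> t _; rewrite adde_ge0.
- exact: emeasurable_funD.
- exact: emeasurable_funD.
move=> t _; rewrite /M -EFinM.
apply: le_trans (ereal_amgm (p0 x t) (p0 y t) (f0 t) (g0 t) (fg t)).
have -> : (p x t * p y t = (k * p m t) ^+ 2)%R.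
  rewrite /p normal_pdfE// /normal_fun /k /m !exprMn -!expRM_natl.
  rewrite mulrACA -expRD mulrCA -expr2 -expRD.
  by congr (_ * expR _)%R; field.
by rewrite sqrtr_sqr ger0_norm// mulr_ge0// ltW.
Qed.

End gaussian_affinity.

(** * Packings and codes with a common Gram matrix *)

Section packing.
Local Close Scope classical_set_scope.
Local Open Scope nat_scope.

(** Take a maximal set of pairwise far points: every point is close to some member, so the
    neighbourhoods of the members cover [T]. *)
Lemma packing_exists (T : finType) (close : rel T) (B : nat) :
  reflexive close -> symmetric close -> (forall x, #|close x| <= B) ->
  exists C : {pred T}, (forall x y, x \in C -> y \in C -> close x y -> x = y) /\
    #|T| <= #|C| * B.
Proof.
move=> refl_c sym_c cB.
pose indep (C : {set T}) :=
  [forall x in C, forall y in C, close x y ==> (x == y)].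
have [C maxC] : {C | maxset indep C}.
  apply: ex_maxset; exists finset.set0.
  by apply/forall_inP => x; rewrite finset.in_set0.
have indC : forall x y, x \in C -> y \in C -> close x y -> x = y.
  move=> x y xC yC xy; have /forall_inP/(_ x xC)/forall_inP/(_ y yC) := maxsetp maxC.
  by rewrite xy => /eqP.
exists (fun x => x \in C); split; first by move=> x y; exact: indC.
have cover y : exists2 x, x \in C & close x y.
  have [/exists_inP//|/exists_inPn far] := boolP [exists x in C, close x y].
  exists y => //.
  suff <- : (y |: C)%SET = C by rewrite finset.setU11.
  apply: (maxsetsup maxC); last exact: finset.subsetUr.
  apply/forall_inP => a; rewrite !finset.inE => aC.
  apply/forall_inP => b; rewrite !finset.inE => bC; apply/implyP => ab.
  case/orP: aC => [/eqP ay|aC]; case/orP: bC => [/eqP by_|bC].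
  - by rewrite ay by_.
  - by move: (far _ bC); rewrite sym_c -ay ab.
  - by move: (far _ aC); rewrite -by_ ab.
  - by rewrite (indC a b).
have -> : #|T| = \sum_(y : T) 1 by rewrite sum1_card.
apply: (@leq_trans (\sum_(y : T) \sum_(x in C) close x y)).
  apply: leq_sum => y _; have [x xC xy] := cover y.
  by rewrite (bigD1 x)//= xy leq_addr.
rewrite exchange_big/= -sum_nat_const; apply: leq_sum => x _.
by apply: leq_trans (cB x); rewrite -sum1_card [leqRHS]big_mkcond/=.
Qed.

Lemma pigeonhole_fiber (T G : finType) (A : {pred T}) (f : T -> G) : 0 < #|G| ->
  exists g, #|A| <= #|[pred x in A | f x == g]| * #|G|.
Proof.
move=> G0; have [g0 _] : exists g : G, g \in predT by apply/card_gt0P.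
pose F g := #|[pred x in A | f x == g]|.
pose g := [arg max_(g > g0) F g].
exists g; rewrite -sum1_card (partition_big f predT)//= mulnC -sum_nat_const.
apply: leq_sum => h _; rewrite sum1_card.
rewrite /g; case: arg_maxnP => // k _ /(_ h isT).
by apply: leq_trans; rewrite /F; apply/eq_leq/eq_card.
Qed.

Definition hamming (n q : nat) (x y : {ffun 'I_n -> 'I_q}) :=
  #|[pred i | x i != y i]|.

(** Weigh [y] by the product over [i] of [q] where [x] and [y] agree and [1] elsewhere. Each point
    of the ball weighs at least [q ^ (n - d)], and for [q > 0] the total weight factors into
    [(2 * q - 1) ^ n]. *)
Lemma card_hamming_ball (n q d : nat) (x : {ffun 'I_n -> 'I_q}) : d <= n ->
  #|[pred y | hamming x y < d]| * q ^ (n - d) <= (2 * q) ^ n.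
Proof.
move=> dn; case: q x => [|q] x.
  case: n x dn => [|n] x; last by case: (x ord0).
  rewrite leqn0 => /eqP ->.
  by rewrite expn0 muln1 (@eq_card _ _ pred0) ?card0// => y; rewrite !inE.
apply: (@leq_trans (\sum_(y : {ffun 'I_n -> 'I_q.+1})
    \prod_(i < n) (if x i == y i then q.+1 else 1))).
  rewrite -sum1_card big_distrl/= [leqLHS]big_mkcond/=; apply: leq_sum => y _.
  rewrite inE; case: ifP => // hxy; rewrite mul1n -big_mkcond/= prod_nat_const.
  rewrite leq_pexp2l//.
  have nE : (hamming x y + #|[pred i | x i == y i]| = n)%N.
    rewrite -[RHS]card_ord -(cardC [pred i | x i != y i]); congr (_ + _).
    by apply: eq_card => i; rewrite !inE negbK.
  by rewrite leq_subLR -[leqLHS]nE leq_add2r ltnW.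
rewrite -(bigA_distr_bigA (fun i b => if x i == b then q.+1 else 1)).
rewrite -[X in _ <= _ ^ X]card_ord -prod_nat_const; apply: leq_prod => i _.
rewrite (bigD1 (x i))//= eqxx mul2n -addnn leq_add2l.
rewrite (eq_bigr (fun=> 1)); last by move=> b /negbTE; rewrite eq_sym => ->.
by rewrite sum1_card -[leqRHS]card_ord max_card.
Qed.

Lemma hamming_code_exists (n q d : nat) : d <= n -> 0 < q ->
  exists C : {pred {ffun 'I_n -> 'I_q}},
    (forall x y, x \in C -> y \in C -> x != y -> d <= hamming x y) /\
    q ^ n <= #|C| * (2 ^ n * q ^ d).
Proof.
move=> dn q0; case: d dn => [|d] dn.
  exists (fun=> true); split => //; rewrite expn0 muln1 (@eq_card _ _ predT)//.
  by rewrite card_ffun !card_ord leq_pmulr// expn_gt0.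
have cl x : #|[rel x y : {ffun 'I_n -> 'I_q} | hamming x y < d.+1] x| <=
    2 ^ n * q ^ d.+1.
  rewrite -(@leq_pmul2r (q ^ (n - d.+1))) ?expn_gt0 ?q0//.
  apply: leq_trans (card_hamming_ball x dn) _.
  by rewrite -mulnA -expnD subnKC// expnMn.
have [||C [CC cardC]] := packing_exists _ _ cl.
- by move=> x; rewrite /= /hamming (@eq_card _ _ pred0) ?card0// => i; rewrite !inE eqxx.
- by move=> x y; rewrite /= /hamming; congr (_ < _); apply: eq_card => i; rewrite !inE eq_sym.
exists C; split; last by move: cardC; rewrite card_ffun !card_ord.
move=> x y xC yC; apply: contraNT; rewrite -ltnNge => hxy.
by rewrite (CC x y).
Qed.

End packing.

Lemma normr_natB_le_sqr {R : realDomainType} (a b : nat) :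
  `|a%:R - b%:R| <= (a%:R - b%:R) ^+ 2 :> R.
Proof.
wlog ba : a b / (b <= a)%N => [H|].
  have [/H//|/ltnW/H] := leqP b a.
  by rewrite distrC -sqrrN opprB.
by rewrite -natrB// normr_nat -natrX ler_nat; case: (a - b)%N => // c; rewrite leq_pmulr.
Qed.

Lemma sqr_natB_ge1 {R : realDomainType} (a b : nat) : a != b ->
  1 <= (a%:R - b%:R) ^+ 2 :> R.
Proof.
move=> ab; rewrite -real_normK ?num_real// exprn_ege1//.
wlog ba : a b ab / (b < a)%N => [H|].
  by case: (ltngtP a b) ab => // ab _; [rewrite distrC|]; apply: H => //;
    rewrite ?(gtn_eqF ab)// neq_ltn ab ?orbT.
by rewrite -natrB ?(ltnW ba)// normr_nat ler1n subn_gt0.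
Qed.

(* The summands with [m < l] are controlled because, the Gram matrices being
   equal, [<k l, k m - k' m> = <k' l - k l, k' m>]. *)
Lemma top_level_separation {R : realDomainType} (n L : nat)
    (k k' : 'I_L -> 'I_n -> R) (q Q : R) (l : 'I_L) :
  4 * q <= Q - 1 -> 0 <= q ->
  (forall m i, 0 <= k' m i <= q) ->
  (forall m : 'I_L, (l < m)%N -> k m =1 k' m) ->
  (forall m, \sum_i k l i * k m i = \sum_i k' l i * k' m i) ->
  (forall i, `|k l i - k' l i| <= (k l i - k' l i) ^+ 2) ->
  \sum_i (k l i - k' l i) ^+ 2 <=
  4 * \sum_i k l i * (\sum_(m < L) Q ^+ m * k m i - \sum_(m < L) Q ^+ m * k' m i).
Proof.
move=> qQ q0 k'q above gram integral_diff.
set D := \sum_i _; have D0 : 0 <= D by apply: sumr_ge0 => i _; exact: sqr_ge0.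
have Q1 : 1 <= Q by nra.
pose e m := \sum_i k l i * (k m i - k' m i).
have e_above (m : 'I_L) : (l < m)%N -> e m = 0.
  by move=> lm; apply: big1 => i _; rewrite (above m lm i) subrr mulr0.
have e_l : 2 * e l = D.
  have -> : e l = \sum_i k l i * k l i - \sum_i k l i * k' l i.
    by rewrite -sumrB; apply: eq_bigr => i _; rewrite mulrBr.
  have -> : D = \sum_i k l i * k l i - 2 * (\sum_i k l i * k' l i) +
      \sum_i k' l i * k' l i.
    rewrite mulr_sumr -sumrB -big_split/=; apply: eq_bigr => i _; ring.
  rewrite -gram; ring.
have e_ge m : - (q * D) <= e m.
  have -> : e m = \sum_i (k' l i - k l i) * k' m i.
    rewrite /e; under eq_bigr do rewrite mulrBr.
    by rewrite sumrB gram -sumrB; apply: eq_bigr => i _; rewrite mulrBl.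
  rewrite mulr_sumr -sumrN; apply: ler_sum => i _.
  have /andP[k0 kq] := k'q m i; have := integral_diff i.
  rewrite ler_norml => /andP[? ?]; have := sqr_ge0 (k l i - k' l i); nra.
have -> : \sum_i k l i * (\sum_(m < L) Q ^+ m * k m i - \sum_(m < L) Q ^+ m * k' m i) =
    \sum_(m < L) Q ^+ m * e m.
  under eq_bigr do rewrite -sumrB mulr_sumr.
  rewrite exchange_big/=; apply: eq_bigr => m _; rewrite mulr_sumr.
  by apply: eq_bigr => i _; ring.
rewrite (bigD1 l)//= (bigID (fun m : 'I_L => (m < l)%N))/=.
rewrite [X in _ + (_ + X)]big1 ?addr0; last first.
  move=> m /andP[ml]; rewrite -leqNgt => lm; rewrite e_above ?mulr0//.
  by rewrite ltn_neqAle lm andbT eq_sym.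
(* Bounding [4 * q] by [Q - 1] makes the geometric sum telescope. The lower levels thus cost at most
   [Q ^ l * D / 4], against [Q ^ l * D / 2] gained at level [l]. *)
have geom : 4 * q * \sum_(m < L | (m != l) && (m < l)%N) Q ^+ m <= Q ^+ l.
  rewrite (eq_bigl (fun m : 'I_L => (m < l)%N)); last first.
    by move=> m; case: ltngtP => [ml|ml|/val_inj ->]; rewrite ?andbT ?andbF ?eqxx//;
       apply: contraTT ml => /negPn/eqP ->; rewrite ltnn.
  rewrite -(big_ord_widen _ (fun m => Q ^+ m) (ltnW (ltn_ord l))).
  have S0 : 0 <= \sum_(m < l) Q ^+ m.
    by apply: sumr_ge0 => m _; rewrite exprn_ge0//; lra.
  apply: (@le_trans _ _ ((Q - 1) * \sum_(m < l) Q ^+ m)); first exact: ler_wpM2r.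
  by rewrite -subrX1 lerBlDr lerDl.
have low : - (q * D * \sum_(m < L | (m != l) && (m < l)%N) Q ^+ m) <=
    \sum_(m < L | (m != l) && (m < l)%N) Q ^+ m * e m.
  rewrite mulr_sumr -sumrN; apply: ler_sum => m _.
  by rewrite mulrC -mulrN ler_wpM2l// exprn_ge0//; lra.
have Ql1 : 1 <= Q ^+ l by exact: exprn_ege1.
move: geom low e_l; set s := \sum_(m < L | _) Q ^+ m; set t := \sum_(m < L | _) _.
move: (e l) (Q ^+ l) Ql1 => el P P1 geom low e_l.
have : 4 * q * s * D <= P * D by exact: ler_wpM2r.
have : D <= P * D by rewrite ler_peMl.
rewrite -e_l in D0 low *; nra.
Qed.

(** The words of each level come from a code of distance [d], and [S] is a class of such [L]-tuples
    with a common Gram matrix, large by pigeonhole: the [L * L] entries are at most [n * q ^ 2]. The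
    base [4 * q + 1] is the least that [top_level_separation] accepts. *)
Lemma identification_codewords_exist {R : realDomainType} (n q L d : nat) :
  (d <= n)%N -> (0 < q)%N ->
  exists S : {pred {ffun 'I_L -> {ffun 'I_n -> 'I_q}}},
  (forall x y, x \in S -> y \in S -> x != y -> exists l, d%:R <= 4 *
    \sum_i (x l i)%:R * (\sum_(m < L) (4 * q%:R + 1) ^+ m * (x m i)%:R
                         - \sum_(m < L) (4 * q%:R + 1) ^+ m * (y m i)%:R) :> R) /\
  (q ^ (n * L) <= #|S| * (n * q ^ 2).+1 ^ (L * L) * (2 ^ n * q ^ d) ^ L)%N.
Proof.
move=> dn q0; have [C [sepC cardC]] := hamming_code_exists dn q0.
pose gram (x : {ffun 'I_L -> {ffun 'I_n -> 'I_q}}) (l m : 'I_L) :=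
  (\sum_i x l i * x m i)%N.
have gram_le x l m : (gram x l m < (n * q ^ 2).+1)%N.
  rewrite ltnS -[X in (_ <= X * _)%N]card_ord -sum_nat_const leq_sum// => i _.
  by rewrite leq_mul// ltnW.
pose G (x : {ffun 'I_L -> {ffun 'I_n -> 'I_q}}) :
    {ffun 'I_L * 'I_L -> 'I_(n * q ^ 2).+1} := [ffun lm => inord (gram x lm.1 lm.2)].
have [|g cardg] := pigeonhole_fiber (ffun_on C) G.
  by rewrite card_ffun card_ord expn_gt0.
exists (fun x => (x \in ffun_on C) && (G x == g)); split; last first.
  rewrite expnM; apply: (@leq_trans ((#|C| * (2 ^ n * q ^ d)) ^ L)%N).
    by have [->//|L0] := posnP L; rewrite leq_exp2r.
  rewrite expnMn leq_mul2r; apply/orP; right.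
  move: cardg; rewrite card_ffun_on card_ffun card_prod !card_ord; exact.
move=> x y /andP[/ffun_onP xC /eqP Gx] /andP[/ffun_onP yC /eqP Gy] xy.
have /existsP[l0 xyl0] : [exists l, x l != y l].
  by rewrite -negb_forall; apply: contra xy => /forallP xy; apply/eqP/ffunP => l;
     apply/eqP.
pose l := [arg max_(l > l0 | x l != y l) l].
have [xyl above] : x l != y l /\ forall m : 'I_L, (l < m)%N -> x m = y m.
  rewrite /l; case: arg_maxnP => // l1 xyl1 maxl1; split => // m lm.
  by apply/eqP; apply: contraTT lm => xym; rewrite -leqNgt; exact: maxl1.
have gramE m : gram x l m = gram y l m.
  have := congr1 (fun h : {ffun _} => nat_of_ord (h (l, m))) (etrans Gx (esym Gy)).
  by rewrite !ffunE !inordK.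
exists l.
apply: le_trans (top_level_separation (q := q%:R) (l := l)
  (k := fun m i => (x m i)%:R) (k' := fun m i => (y m i)%:R) _ _ _ _ _ _).
- apply: (@le_trans _ _ (hamming (x l) (y l))%:R); first by rewrite ler_nat sepC.
  rewrite /hamming -sum1_card natr_sum big_mkcond/=; apply: ler_sum => i _.
  case: ifP => [|_]; last exact: sqr_ge0.
  rewrite inE => xyi.
  exact: sqr_natB_ge1.
- by rewrite addrK.
- exact: ler0n.
- by move=> m i; rewrite ler0n ler_nat ltnW.
- by move=> m lm i; rewrite above.
- move=> m; transitivity ((gram x l m)%:R : R).
    by rewrite natr_sum; apply: eq_bigr => i _; rewrite natrM.
  by rewrite gramE natr_sum; apply: eq_bigr => i _; rewrite natrM.
- by move=> i; exact: normr_natB_le_sqr.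
Qed.

(** * Exponential tail bounds for weighted Bernoulli sums *)

Section concentration.
Context {R : realType}.

(** From [exp x <= 1 / (1 - x)], since [(1 + x + 2 * x ^ 2) * (1 - x) = 1 + x ^ 2 * (1 - 2 * x) >=
    1]. *)
Lemma expR_le_quadratic (x : R) : x <= 2^-1 -> expR x <= 1 + x + 2 * x ^+ 2.
Proof.
move=> x2; have e0 := expR_gt0 x.
have : expR x * expR (- x) = 1 by rewrite -expRD subrr expR0.
have := expR_ge1Dx (- x) => h e1.
have : expR x * (1 - x) <= 1 by rewrite -[leRHS]e1 ler_wpM2l ?(ltW e0).
move=> h1; have x1 : 0 < 1 - x by lra.
rewrite -(ler_pM2r x1); apply: (le_trans h1).
have := sqr_ge0 x; nra.
Qed.

Context {d : measure_display} {Y : measurableType d}.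

(** The linear terms cancel because the variable is centred, and its variance [t * (1 - t)] is at
    most [1]. *)
Lemma bernoulli_mgf_le (P : probability Y R) (A : set Y) (t a : R) :
  measurable A -> P A = t%:E -> `|a| <= 2^-1 ->
  (\int[P]_y (expR (a * (\1_A y - t)))%:E <= (expR (2 * a ^+ 2))%:E)%E.
Proof.
move=> mA PA; rewrite ler_norml => /andP[a1 a2].
have /andP[t0 t1] : 0 <= t <= 1.
  by apply/andP; rewrite -2!lee_fin -PA; split; [exact: measure_ge0|exact: probability_le1].
have -> : (\int[P]_y (expR (a * (\1_A y - t)))%:E =
    \int[P]_y (if y \in A then expR (a * (1 - t)) else expR (- (a * t)))%:E)%E.
  apply: eq_integral => y _; rewrite indicE; case: (y \in A) => //.
  by rewrite sub0r mulrN.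
rewrite integral_two_valued ?expR_ge0// PA -EFinB -!EFinM -EFinD lee_fin.
have h1 : expR (a * (1 - t)) <= 1 + a * (1 - t) + 2 * (a * (1 - t)) ^+ 2.
  by apply: expR_le_quadratic; nra.
have h2 : expR (- (a * t)) <= 1 - a * t + 2 * (- (a * t)) ^+ 2.
  by apply: expR_le_quadratic; nra.
apply: le_trans (expR_ge1Dx _).
apply: (@le_trans _ _ ((1 + a * (1 - t) + 2 * (a * (1 - t)) ^+ 2) * t +
    (1 - a * t + 2 * (- (a * t)) ^+ 2) * (1 - t))).
  by apply: lerD; apply: ler_wpM2r => //; lra.
have a20 := sqr_ge0 a.
have : 0 <= t * (1 - t) <= 1 by rewrite mulr_ge0 ?subr_ge0//=; nra.
move=> /andP[tt0 tt1].
have -> : (1 + a * (1 - t) + 2 * (a * (1 - t)) ^+ 2) * t +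
    (1 - a * t + 2 * (- (a * t)) ^+ 2) * (1 - t) =
    1 + 2 * a ^+ 2 * (t * (1 - t)) by ring.
by rewrite lerD2l ler_piMr// mulr_ge0.
Qed.

Definition bernoulli_statistic (A : set Y) (n : nat) (t a : 'I_n -> R)
  (y : n.-tuple Y) : R := \sum_(i < n) a i * (\1_A (tnth y i) - t i).

Lemma measurable_bernoulli_statistic (A : set Y) (n : nat) (t a : 'I_n -> R) :
  measurable A -> measurable_fun setT (bernoulli_statistic A t a).
Proof.
move=> mA; apply: measurable_sum => i; apply: measurable_funM => //.
apply: measurable_funB => //.
by apply: (measurableT_comp _ (measurable_tnth i)); exact: measurable_indic.
Qed.

Lemma measurable_statistic_ge (A : set Y) (n : nat) (t a : 'I_n -> R) (T : R) :
  measurable A -> measurable [set y | T <= bernoulli_statistic A t a y].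
Proof.
move=> mA; rewrite -[X in measurable X]setTI.
have -> : [set y | T <= bernoulli_statistic A t a y] =
    bernoulli_statistic A t a @^-1` `[T, +oo[%classic.
  by apply/seteqP; split => y /=; rewrite in_itv/= andbT.
exact: measurable_bernoulli_statistic.
Qed.

(** Markov's inequality for the exponential of the statistic. No exponent is optimized: the
    normalization of [a] already bounds the exponential moment by [expR 1]. *)
Lemma bernoulli_statistic_chernoff (n : nat) (P : 'I_n -> probability Y R)
    (A : set Y) (t a : 'I_n -> R) (T : R) :
  measurable A -> (forall i, P i A = (t i)%:E) -> (forall i, `|a i| <= 2^-1) ->
  \sum_i a i ^+ 2 <= 2^-1 ->
  (product_law P [set y | (T <= bernoulli_statistic A t a y)%R] <=
   (expR (1 - T))%:E)%E.
Proof.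
move=> mA PA a2 sa2; set B := [set y | _].
have mB : measurable B by exact: measurable_statistic_ge.
pose f i (y : Y) := (expR (a i * (\1_A y - t i)))%:E.
have mf i : measurable_fun setT (f i).
  apply/measurable_EFinP; apply: measurableT_comp => //.
  by apply: measurable_funM => //; apply: measurable_funB.
have f0 i y : (0 <= f i y)%E by rewrite lee_fin expR_ge0.
have fE (y : n.-tuple Y) : (\prod_(i < n) f i (tnth y i) =
    (expR (bernoulli_statistic A t a y))%:E)%E.
  by rewrite /bernoulli_statistic expR_sum prodEFin.
have : ((expR T)%:E * product_law P B <= (expR 1)%:E)%E.
  apply: (@le_trans _ _ (\int[product_law P]_y \prod_(i < n) f i (tnth y i))%E).
    have -> : ((expR T)%:E * product_law P B =
        \int[product_law P]_y ((expR T)%:E * (\1_B y)%:E))%E.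
      have mI : measurable_fun setT (fun y => (\1_B y)%:E : \bar R).
        by apply/measurable_EFinP; exact: measurable_indic.
      rewrite (ge0_integralZl _ measurableT mI) ?lee_fin ?expR_ge0//.
      by rewrite integral_indic// setIT.
    apply: ge0_le_integral; first exact: measurableT.
    - by move=> y _; rewrite mule_ge0// lee_fin ?expR_ge0.
    - by apply: measurable_funeM; apply/measurable_EFinP; exact: measurable_indic.
    - under eq_fun do rewrite fE; apply/measurable_EFinP.
      by apply: measurableT_comp => //; exact: measurable_bernoulli_statistic.
    - move=> y _; rewrite fE indicE.
      have [/set_mem yB|_] := boolP (y \in B).
        by rewrite mule1 lee_fin ler_expR.
      by rewrite mule0 lee_fin expR_ge0.
  rewrite ge0_integral_product_lawM//.
  apply: (@le_trans _ _ (\prod_(i < n) (expR (2 * a i ^+ 2))%:E)%E).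
    pose le0 (x y : \bar R) := (0 <= x)%E /\ (x <= y)%E.
    suff [] : le0 (\prod_(i < n) \int[P i]_y f i y)%E
        (\prod_(i < n) (expR (2 * a i ^+ 2))%:E)%E by [].
    elim/big_ind2: _ => [|x1 x2 y1 y2 [x10 x12] [y10 y12]|i _].
    - by split.
    - by split; [exact: mule_ge0|exact: lee_pmul].
    - by split; [exact: integral_ge0|exact: bernoulli_mgf_le].
  rewrite prodEFin lee_fin -expR_sum ler_expR -mulr_sumr; lra.
rewrite -[X in (_ <= X)%E -> _]mul1e muleC -lee_pdivlMr ?expR_gt0//.
by rewrite mul1e -EFinM expRB.
Qed.

End concentration.

(** * Construction of identification codes *)

Section lower_bound.
Context {R : realType} {X : Type} {d : measure_display} {Y : measurableType d}.
Variables (W : X -> probability Y R) (K : input_constraint (X := X)).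

Lemma DI_code_le (n N N' : nat) (l1 l2 l1' l2' : R) :
  (N <= N')%N -> l1' <= l1 -> l2' <= l2 ->
  DI_code W K n N' l1' l2' -> DI_code W K n N l1 l2.
Proof.
move=> NN' l11 l22 [u [D [Ku mD uD]]].
exists (u \o widen_ord NN'), (D \o widen_ord NN'); split => [i|i|i j ij] /=.
- exact: Ku.
- exact: mD.
have [|h1 h2] := uD (widen_ord NN' i) (widen_ord NN' j).
  by apply: contra ij => /eqP[/val_inj ->].
split; first by apply: le_trans h1; rewrite lee_fin lerB.
by apply: (le_trans h2); rewrite lee_fin.
Qed.

(** Serves the finitely many block lengths where the construction may not apply. *)
Lemma DI_code0 (n : nat) (l1 l2 : R) : DI_code W K n 0 l1 l2.
Proof.
exists (fun i : 'I_0 => False_rect _ (notF (ltn_ord i))), (fun=> set0).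
by split => -[].
Qed.

Variable A : set Y.
Hypothesis mA : measurable A.

(** Decoder [j] rejects when one of its [L] statistics, with weights [- a j l] and centred at [v j],
    reaches [T]; a union bound controls the first error. If [j] is sent and decoder [h] accepts, the
    separation [2 * T] of the means forces a statistic with weights [a h l], centred at the true
    means [v j], above [T]. *)
Lemma DI_code_separated (n N L : nat) (u : 'I_N -> n.-tuple X)
    (v : 'I_N -> 'I_n -> R) (a : 'I_N -> 'I_L -> 'I_n -> R) (T : R) :
  (forall j, K (u j)) -> (forall j i, W (tnth (u j) i) A = (v j i)%:E) ->
  (forall j l i, `|a j l i| <= 2^-1) ->
  (forall j l, \sum_i a j l i ^+ 2 <= 2^-1) ->
  (forall j h, j != h -> exists l, 2 * T <= \sum_i a j l i * (v j i - v h i)) ->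
  DI_code W K n N (L%:R * expR (1 - T)) (expR (1 - T)).
Proof.
move=> Ku uv a2 sa2 sep.
pose B j l := [set y | T <= bernoulli_statistic A (v j) (fun i => - a j l i) y].
have mB j l : measurable (B j l) by exact: measurable_statistic_ge.
pose U j := \big[setU/set0]_(l < L) B j l.
have mU j : measurable (U j) by exact: bigsetU_measurable.
exists u, (fun j => ~` U j); split; [by []|by move=> j; exact: measurableC|move=> j h jh].
split.
  rewrite probability_setC// EFinB leeB//.
  have PU : (memoryless W (u j) (U j) <=
      \sum_(l < L) memoryless W (u j) (B j l))%E.
    rewrite /U; elim: (index_enum _) => [|l s IHs].
      by rewrite !big_nil measure0.
    rewrite !big_cons; apply: le_trans (measureU2 _ _ _) _ => //.
      exact: bigsetU_measurable.
    exact: leeD.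
  apply: (le_trans PU); apply: (@le_trans _ _ (\sum_(l < L) (expR (1 - T))%:E)%E).
    apply: lee_sum => l _; apply: bernoulli_statistic_chernoff => //.
    - by move=> i; rewrite normrN.
    - by under eq_bigr do rewrite sqrrN.
  by rewrite sumEFin sumr_const card_ord mulr_natl.
have hj : h != j by rewrite eq_sym.
have [l sepl] := sep _ _ hj.
apply: le_trans (bernoulli_statistic_chernoff T mA (uv j) (a2 h l) (sa2 h l)).
apply: le_measure; rewrite ?inE; [exact: measurableC|exact: measurable_statistic_ge|].
move=> y /= nU.
have : ~ B h l y by apply: contra_not nU => By; rewrite /U (bigD1 l)//=; left.
rewrite /B /= /bernoulli_statistic => /negP; rewrite -ltNge => Sh.
have -> : \sum_(i < n) a h l i * (\1_A (tnth y i) - v j i) =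
    \sum_(i < n) a h l i * (v h i - v j i) -
    \sum_(i < n) (- a h l i) * (\1_A (tnth y i) - v h i).
  by rewrite -sumrB; apply: eq_bigr => i _; ring.
lra.
Qed.

Variables (a b : R) (x_ : R -> X).
Hypothesis ab : a < b.
Hypothesis x_A : forall t, a <= t <= b -> W (x_ t) A = t%:E.
Hypothesis x_K : forall n (u : n.-tuple X),
  (forall i, exists2 t, a <= t <= b & tnth u i = x_ t) -> K u.

(** [k] is the distance of the code used at each level. The resulting separation [k / 4] is scaled
    by [(b - a) / Q ^ L] in the means and by [1 / (2 * sqrt n * q)] in the weights, the latter to
    meet the normalization of the tail bound; [T] is half of the result. *)
Lemma DI_code_levels (n q L k : nat) (Q := 4 * q%:R + 1 : R)
    (T := (b - a) * k%:R / (16 * Num.sqrt n%:R * q%:R * Q ^+ L)) :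
  (k <= n)%N -> (0 < n)%N -> (0 < q)%N -> exists M,
  DI_code W K n M (L%:R * expR (1 - T)) (expR (1 - T)) /\
  (q ^ (n * L) <= M * (n * q ^ 2).+1 ^ (L * L) * (2 ^ n * q ^ k) ^ L)%N.
Proof.
move=> kn n0 q0.
have [S [sepS cardS]] := @identification_codewords_exist R n q L k kn q0.
exists #|S|; split => //.
have qgt0 : 0 < q%:R :> R by rewrite ltr0n.
have Q0 : 0 < Q by rewrite /Q; lra.
have QL0 : 0 < Q ^+ L by rewrite exprn_gt0.
pose s : R := Num.sqrt n%:R.
have s0 : 0 < s by rewrite sqrtr_gt0 ltr0n.
have s2 : s ^+ 2 = n%:R by rewrite sqr_sqrtr.
have s1 : 1 <= s by rewrite -ler_sqr ?nnegrE ?(ltW s0)// s2 expr1n ler1n.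
pose x (j : 'I_#|S|) := enum_val j.
pose w j i : R := \sum_(m < L) Q ^+ m * (x j m i)%:R.
have w0 j i : 0 <= w j i.
  by apply: sumr_ge0 => m _; rewrite mulr_ge0// exprn_ge0// ltW.
have wQ j i : w j i <= Q ^+ L.
  apply: (@le_trans _ _ ((Q - 1) * \sum_(m < L) Q ^+ m)).
    rewrite mulr_sumr; apply: ler_sum => m _; rewrite mulrC ler_wpM2r//.
      by rewrite exprn_ge0// ltW.
    have : (x j m i)%:R <= q%:R :> R by rewrite ler_nat ltnW.
    by rewrite /Q; lra.
  by rewrite -subrX1 gerBl.
pose v j i := a + (b - a) / Q ^+ L * w j i.
have vab j i : a <= v j i <= b.
  have c0 : 0 <= (b - a) / Q ^+ L by rewrite divr_ge0 ?subr_ge0 ?(ltW ab) ?(ltW QL0).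
  apply/andP; split; first by rewrite lerDl mulr_ge0.
  rewrite /v -lerBrDl -[leRHS](divfK (lt0r_neq0 QL0)).
  exact: ler_wpM2l.
pose al j l i : R := (x j l i)%:R / (2 * s * q%:R).
have al0 j l i : 0 <= al j l i by rewrite divr_ge0// !mulr_ge0 ?(ltW s0) ?(ltW qgt0).
have al1 j l i : al j l i <= (2 * s)^-1.
  have -> : (2 * s)^-1 = q%:R / (2 * s * q%:R) by field; rewrite !gt_eqF.
  rewrite /al ler_pM2r; last by rewrite invr_gt0 !mulr_gt0.
  by rewrite ler_nat; exact/ltnW/ltn_ord.
apply: (DI_code_separated (u := fun j => [tuple x_ (v j i) | i < n]) (v := v) (a := al)).
- move=> j; apply: x_K => i; exists (v j i) => //; exact: tnth_mktuple.
- by move=> j i; rewrite tnth_mktuple x_A.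
- move=> j l i; rewrite ger0_norm//; apply: (le_trans (al1 _ _ _)).
  by rewrite lef_pV2 ?posrE ?mulr_gt0// ler_peMr.
- move=> j l; apply: (@le_trans _ _ (\sum_(i < n) (2 * s)^-1 ^+ 2)).
    apply: ler_sum => i _; apply: lerXn2r (al1 _ _ _); rewrite nnegrE//.
    by rewrite invr_ge0 mulr_ge0// ltW.
  rewrite sumr_const card_ord -[_ *+ n]mulr_natl exprVn exprMn s2.
  have -> : n%:R * (2 ^+ 2 * n%:R)^-1 = 4^-1 :> R.
    by field; rewrite pnatr_eq0 -lt0n.
  lra.
- move=> j h jh.
  have [|l sepl] := sepS _ _ (enum_valP j) (enum_valP h).
  by rewrite (inj_eq enum_val_inj).
exists l.
have -> : \sum_(i < n) al j l i * (v j i - v h i) =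
    (b - a) / (2 * s * q%:R * Q ^+ L) * \sum_(i < n) (x j l i)%:R * (w j i - w h i).
  rewrite mulr_sumr; apply: eq_bigr => i _; rewrite /al /v !invfM; ring.
have -> : 2 * T = (b - a) / (2 * s * q%:R * Q ^+ L) * (k%:R / 4).
  rewrite /T -/s; field.
  by rewrite !gt_eqF.
rewrite ler_wpM2l//; last by rewrite ler_pdivrMr// mulrC.
by rewrite divr_ge0 ?subr_ge0 ?(ltW ab)// !mulr_ge0 ?(ltW s0) ?(ltW QL0).
Qed.

End lower_bound.

(** The alphabet size [q] is the integer part of [expR (g n)], where
    [n = expR (g n) ^ (2 * (L + 2))]. Distance [n / L] gives a threshold of order
    [sqrt n / q ^ (L + 1)], that is [expR (g n)], which tends to infinity. About [q ^ (n * (L - 1))]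
    words remain, hence the rate [(L - 1) / (2 * (L + 2))]. *)
Lemma DI_code_linearithmic {R : realType} {X : Type} {d : measure_display}
    {Y : measurableType d} (W : X -> probability Y R)
    (K : input_constraint (X := X)) (A : set Y) (a b : R) (x_ : R -> X)
    (r : R) (L : nat) (g := fun n : nat => ln n%:R / (2 * (L + 2)%:R) : R)
    (c := (b - a) / (32 * L%:R * 5 ^+ L)) (l := fun n => expR (1 - c * expR (g n))) :
  measurable A -> a < b -> (forall t, a <= t <= b -> W (x_ t) A = t%:E) ->
  (forall n (u : n.-tuple X),
    (forall i, exists2 t, a <= t <= b & tnth u i = x_ t) -> K n u) ->
  (0 < L)%N -> r < (L%:R - 1) / (2 * (L + 2)%:R) ->
  \forall n \near \oo,
    DI_code W K n (Num.truncn (expR (r * (n%:R * ln n%:R)))) (L%:R * l n) (l n).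
Proof.
move=> mA ab xA xK L0 rL.
have L0' : 1 <= L%:R :> R by rewrite ler1n.
(* Losses per letter: [2 * L * ln 2] covers the rounding of [q] and the factors [2 ^ n], and
   [3 * L * L] the number of Gram matrices. *)
pose C : R := (2 * L%:R) * ln 2 + 3 * (L * L)%:R.
near=> n.
have n0 : (0 < n)%N by near: n; exact: nbhs_infty_gt.
have nL : (2 * L <= n)%N by near: n; exact: nbhs_infty_ge.
have n0' : 0 < n%:R :> R by rewrite ltr0n.
have n1 : 1 <= n%:R :> R by rewrite ler1n.
have lnn0 : 0 <= ln n%:R :> R by rewrite ln_ge0.
have L2 : 0 < 2 * (L + 2)%:R :> R by rewrite mulr_gt0// ltr0n addn2.
have g0 : 0 <= g n by rewrite divr_ge0// ltW.
have gE : ln n%:R = 2 * (L + 2)%:R * g n by rewrite /g mulrC divfK// gt_eqF.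
have eg1 : 1 <= expR (g n) by rewrite -expR0 ler_expR.
have eg0 := expR_gt0 (g n).
pose q := Num.truncn (expR (g n)).
have qle : q%:R <= expR (g n) by rewrite truncn_le ltW.
have q0 : (0 < q)%N by rewrite truncn_gt0.
have q0' : 1 <= q%:R :> R by rewrite ler1n.
have qge : expR (g n) <= 2 * q%:R.
  by have := truncnS_gt (expR (g n)); rewrite -/q -natr1; lra.
(* With distance [n / L], the factors [q ^ k] of the [L] levels together cost at most [q ^ n], the
   content of one level. *)
pose k := (n %/ L)%N.
have kL : (k * L <= n)%N by exact: leq_divM.
have kn : (k <= n)%N by exact: leq_div.
have nk : n%:R <= 2 * L%:R * k%:R :> R.
  have k2 : (2 <= k)%N by rewrite leq_divRL.
  rewrite -!natrM ler_nat mulnAC; apply: leq_trans (ltnW (ltn_ceil n L0)) _.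
  by rewrite leq_mul2r; apply/orP; right; rewrite mul2n -addnn -addn1 leq_add2l ltnW.
have [M [codeM cardM]] := DI_code_levels mA ab xA xK L kn n0 q0.
have sn : Num.sqrt n%:R = expR ((L + 2)%:R * g n).
  have -> : n%:R = expR ((L + 2)%:R * g n) ^+ 2 :> R.
    by rewrite -expRM_natl mulrA -gE lnK// posrE.
  by rewrite sqrtr_sqr ger0_norm// expR_ge0.
have Tge : c * expR (g n) <= (b - a) * k%:R /
    (16 * Num.sqrt n%:R * q%:R * (4 * q%:R + 1) ^+ L).
  have Q0 : 0 < 4 * q%:R + 1 :> R by lra.
  have s0 : 0 < Num.sqrt n%:R :> R by rewrite sqrtr_gt0.
  rewrite ler_pdivlMr; last by rewrite !mulr_gt0 ?exprn_gt0// (lt_le_trans _ q0').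
  have QE : (4 * q%:R + 1) ^+ L <= (5 * expR (g n)) ^+ L.
    by rewrite lerXn2r ?nnegrE ?mulr_ge0 ?(ltW Q0) ?(ltW eg0)//; lra.
  have qQE : q%:R * (4 * q%:R + 1) ^+ L <= expR (g n) * (5 * expR (g n)) ^+ L.
    by apply: ler_pM => //; rewrite exprn_ge0 ?(ltW Q0).
  have sE : expR (g n) * (expR (g n) * (5 * expR (g n)) ^+ L) =
      5 ^+ L * Num.sqrt n%:R.
    by rewrite sn expRM_natl addn2 !exprS exprMn; ring.
  have c0 : 0 <= c.
    by rewrite divr_ge0 ?subr_ge0 ?(ltW ab)// !mulr_ge0 ?exprn_ge0.
  have s2 : Num.sqrt n%:R * Num.sqrt n%:R = n%:R :> R.
    by rewrite -expr2 sqr_sqrtr.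
  apply: (@le_trans _ _ (c * 16 * Num.sqrt n%:R * (expR (g n) *
      (expR (g n) * (5 * expR (g n)) ^+ L)))).
    have -> : c * expR (g n) * (16 * Num.sqrt n%:R * q%:R * (4 * q%:R + 1) ^+ L) =
        c * 16 * Num.sqrt n%:R * (expR (g n) * (q%:R * (4 * q%:R + 1) ^+ L)) by ring.
    apply: ler_wpM2l; first by apply: mulr_ge0 (ltW s0); exact: mulr_ge0.
    exact: (ler_wpM2l (ltW eg0)).
  rewrite sE; have -> : c * 16 * Num.sqrt n%:R * (5 ^+ L * Num.sqrt n%:R) =
      (b - a) * (n%:R / (2 * L%:R)).
    rewrite -[in RHS]s2 /c; field.
    by rewrite !gt_eqF ?exprn_gt0//; lra.
  by rewrite ler_wpM2l ?subr_ge0 ?(ltW ab)// ler_pdivrMr 1?mulrC//; lra.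
apply: (DI_code_le (N' := M) _ _ _ codeM).
- rewrite -(ler_nat R); apply: (@le_trans _ _ (expR (r * (n%:R * ln n%:R)))).
    by rewrite truncn_le expR_ge0.
  have prod0 : (0 < M * (n * q ^ 2).+1 ^ (L * L) * (2 ^ n * q ^ k) ^ L)%N.
    by apply: leq_trans cardM; rewrite expn_gt0 q0.
  have M0 : 0 < M%:R :> R.
    by rewrite ltr0n; case: (M) prod0.
  rewrite -[leRHS]lnK ?posrE// ler_expR.
  have q00 : 0 < q%:R :> R by lra.
  have lnq0 : 0 <= ln q%:R :> R by rewrite ln_ge0.
  have : ln (q ^ (n * L))%:R <=
      ln (M * (n * q ^ 2).+1 ^ (L * L) * (2 ^ n * q ^ k) ^ L)%:R :> R.
    by rewrite ler_ln ?posrE ?ltr0n ?expn_gt0 ?q0// ler_nat.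
  rewrite !natrM !natrX natrM !natrX.
  have p1 : 0 < (n * q ^ 2).+1%:R :> R by rewrite ltr0n.
  have p2 : 0 < 2 ^+ n * q%:R ^+ k :> R by rewrite mulr_gt0 ?exprn_gt0.
  rewrite !(lnM, lnXn) ?posrE ?mulr_gt0 ?exprn_gt0//.
  move=> lnle; have big : ln q%:R * (n * L)%:R <= ln M%:R +
      ln (n * q ^ 2).+1%:R * (L * L)%:R +
      (ln 2 * n%:R + ln q%:R * k%:R) * L%:R :> R.
    by rewrite !mulr_natr.
  clear lnle; rewrite !natrM in big.
  have lnq : g n - ln 2 <= ln q%:R.
    rewrite lerBlDl -lnM ?posrE// -[leLHS]expRK ler_ln ?posrE ?mulr_gt0//.
  have lnp : ln (n * q ^ 2).+1%:R <= 3 * n%:R :> R.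
    rewrite -[leRHS]expRK ler_ln ?posrE ?expR_gt0// expRM_natl.
    have q2n : q%:R ^+ 2 <= n%:R :> R.
      apply: (@le_trans _ _ (expR (g n) ^+ 2)); first by rewrite lerXn2r ?nnegrE.
      rewrite -expRM_natl -[leRHS]lnK ?posrE// ler_expR gE ler_wpM2r//.
      by rewrite ler_peMr// ler1n addn2.
    apply: (@le_trans _ _ ((1 + n%:R) ^+ 3)).
      rewrite -natr1 natrM natrX; apply: (@le_trans _ _ (n%:R * n%:R + 1)).
        by rewrite lerD2r ler_wpM2l.
      nra.
    by rewrite lerXn2r ?nnegrE ?addr_ge0 ?expR_ge0 ?expR_ge1Dx.
  have kLr : k%:R * L%:R <= n%:R :> R by rewrite -natrM ler_nat.
  have Cn : C <= ((L%:R - 1) / (2 * (L + 2)%:R) - r) * ln (n%:R : R).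
    by near: n; apply: near_le_mul_ln; rewrite subr_gt0.
  have gl : (L%:R - 1) * g n = (L%:R - 1) / (2 * (L + 2)%:R) * ln n%:R.
    by rewrite /g; ring.
  have h1 : ln q%:R * k%:R * L%:R <= ln q%:R * n%:R :> R.
    by rewrite -mulrA ler_wpM2l.
  have h2 : ln (n * q ^ 2).+1%:R * (L%:R * L%:R) <= 3 * n%:R * (L%:R * L%:R) :> R.
    by rewrite ler_wpM2r// mulr_ge0.
  have h3 : n%:R * (L%:R - 1) * (g n - ln 2) <= n%:R * (L%:R - 1) * ln q%:R.
    by rewrite ler_wpM2l// mulr_ge0// subr_ge0.
  have h4 : n%:R * (r * ln n%:R) <= n%:R * ((L%:R - 1) * g n - C).
    by rewrite ler_wpM2l// gl; lra.
  have h5 : 0 <= n%:R * ln 2 :> R by rewrite mulr_ge0// ln_ge0// ler1n.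
  move: big h1 h2 h3 h4; rewrite /C natrM.
  move: (ln M%:R) (ln q%:R) (ln (n * q ^ 2).+1%:R) => lM lq lp.
  move=> big h1 h2 h3 h4; lra.
- by apply: ler_wpM2l => //; rewrite ler_expR lerD2l lerN2.
- by rewrite ler_expR lerD2l lerN2.
Unshelve. all: by end_near.
Qed.

(** Letters in [G] may be combined freely under [K], which separates the constraint from the
    construction. Rates [1 / 2 - e] are reached by taking [L] large. *)
Lemma linearithmic_DI_capacity_ge {R : realType} {X : Type}
    {d : measure_display} {Y : measurableType d} (W : X -> probability Y R)
    (K : input_constraint (X := X)) (G : set X) (A : set Y) (a b : R) :
  measurable A -> a < b ->
  (forall t, a <= t <= b -> exists2 x, G x & W x A = t%:E) ->
  (forall n (u : n.-tuple X), (forall i, G (tnth u i)) -> K n u) ->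
  ((2^-1)%:E <= linearithmic_DI_capacity W K)%E.
Proof.
move=> mA ab GA GK.
have [x0 _ _] : exists2 x, G x & W x A = a%:E by apply: GA; rewrite lexx ltW.
have /choice[x_ x_P] (t : R) :
    exists x, a <= t <= b -> G x /\ W x A = t%:E.
  have [/GA[x Gx Wx]|_] := boolP (a <= t <= b); first by exists x.
  by exists x0.
have xA t : a <= t <= b -> W (x_ t) A = t%:E by move=> /x_P[].
have xK n (u : n.-tuple X) :
    (forall i, exists2 t, a <= t <= b & tnth u i = x_ t) -> K n u.
  by move=> uP; apply: GK => i; have [t /x_P[Gx _] ->] := uP i.
apply/lee_subgt0Pr => e e0.
(* Achievable rates are positive, so [e] has to be below [1 / 2]; a larger [e] follows from the case
   [e = 1 / 4]. *)
wlog e2 : e e0 / e < 2^-1 => [H|].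
  have [/H->//|e2] := ltP e 2^-1.
  have quarter : (4^-1 : R) < 2^-1 by lra.
  apply: le_trans (H _ _ quarter); last by lra.
  by rewrite -!EFinB lee_fin; lra.
pose r : R := 2^-1 - e.
have r0 : 0 < r by rewrite /r; lra.
rewrite -EFinB -/r; apply: ereal_sup_ubound; exists r => //.
(* Since [(L - 1) / (2 * (L + 2)) = 1 / 2 - 3 / (2 * (L + 2))], any [L > 3 / (2 * e)] brings this
   above [1 / 2 - e]. *)
pose L := (Num.truncn (3 / (2 * e))).+1.
have L0 : (0 < L)%N by [].
have rL : r < (L%:R - 1) / (2 * (L + 2)%:R).
  have L2 : 0 < 2 * (L + 2)%:R :> R by rewrite mulr_gt0// ltr0n addn2.
  have : 3 / (2 * e) < L%:R by exact: truncnS_gt.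
  rewrite ltr_pdivrMr ?mulr_gt0// => Le.
  by rewrite ltr_pdivlMr// natrD /r; nra.
pose c := (b - a) / (32 * L%:R * 5 ^+ L).
pose l (n : nat) := expR (1 - c * expR (ln n%:R / (2 * (L + 2)%:R))).
have code := DI_code_linearithmic mA ab xA xK L0 rL; rewrite -/c -/l in code.
have c0 : 0 < c by rewrite divr_gt0 ?subr_gt0// !mulr_gt0 ?exprn_gt0.
have [N [codeN Nlog]] : exists N : nat -> nat,
    (forall n, DI_code W K n (N n) (L%:R * l n) (l n)) /\
    \forall n \near \oo, N n = Num.truncn (expR (r * (n%:R * ln n%:R))).
  pose M n := Num.truncn (expR (r * (n%:R * ln n%:R))).
  pose P n := DI_code W K n (M n) (L%:R * l n) (l n).
  exists (fun n => if `[< P n >] then M n else 0%N); split.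
    by move=> n; case: asboolP => // _; exact: DI_code0.
  by apply: filterS code => n Pn; rewrite asboolT.
have l_cvg : l n @[n --> \oo] --> (0 : R).
  apply/cvgr0Pnorm_lt => eps eps0; near=> n.
  have n1 : (1 < n)%N by near: n; exact: nbhs_infty_gt.
  rewrite gtr0_norm ?expR_gt0// -[ltRHS]lnK ?posrE// ltr_expR ltrBlDr -ltrBlDl.
  have : 1 - ln eps <= c / (2 * (L + 2)%:R) * ln (n%:R : R).
    near: n; apply: near_le_mul_ln.
    by rewrite divr_gt0// mulr_gt0// ltr0n addn2.
  move=> /le_lt_trans; apply; rewrite mulrAC -mulrA ltr_pM2l//.
  by apply: lt_le_trans (expR_ge1Dx _); rewrite ltrDr.
split => //; exists N, (fun n => L%:R * l n), l; split => //.
  by rewrite -(mulr0 (L%:R : R)); apply: cvgM => //; exact: cvg_cst.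
apply/cvgrPdist_lt => eps eps0; near=> n.
have n2 : (1 < n)%N by near: n; exact: nbhs_infty_gt.
have n0' : 1 < n%:R :> R by rewrite ltr1n.
have lnn0 : 0 < ln n%:R :> R by rewrite ln_gt0.
have nln0 : 0 < n%:R * ln n%:R :> R by rewrite mulr_gt0// ltr0n ltnW.
have -> : N n = Num.truncn (expR (r * (n%:R * ln n%:R))) by near: n.
set E := r * _.
have E0 : 0 < E by rewrite mulr_gt0.
have E1 : 1 <= expR E by rewrite -expR0 ler_expR ltW.
set M := Num.truncn _.
have M0 : (0 < M)%N by rewrite truncn_gt0.
have M1 : 1 <= M%:R :> R by rewrite ler1n.
have ME : ln M%:R <= E.
  by rewrite -[leRHS]expRK ler_ln ?posrE ?expR_gt0 ?ltr0n// truncn_le expR_ge0.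
have EM : E - ln 2 <= ln M%:R.
  rewrite lerBlDl -lnM ?posrE ?ltr0n// -[leLHS]expRK.
  rewrite ler_ln ?posrE ?expR_gt0 ?mulr_gt0 ?ltr0n//.
  by have := truncnS_gt (expR E); rewrite -/M -natr1; lra.
have -> : r - ln M%:R / (n%:R * ln n%:R) = (E - ln M%:R) / (n%:R * ln n%:R).
  by rewrite mulrBl /E mulfK// gt_eqF.
rewrite ger0_norm; last by rewrite divr_ge0 ?subr_ge0// ltW.
rewrite ltr_pdivrMr//; apply: (@le_lt_trans _ _ (ln 2)); first by lra.
have : ln 2 <= eps * ln (n%:R : R) by near: n; exact: near_le_mul_ln.
move=> /le_lt_trans; apply; rewrite mulrCA ltr_pMl// mulr_gt0//.
Unshelve. all: by end_near.
Qed.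

(** * Capacities of the individual channels *)

Lemma measure_tv_distance {R : realType} {d : measure_display}
    {Y : measurableType d} (p q : probability Y R) (A : set Y) :
  measurable A -> `|fine (p A) - fine (q A)| <= tv_distance p q.
Proof.
move=> mA; apply: sup_upper_bound; last by exists A.
split; first by exists `|fine (p A) - fine (q A)|, A.
exists 1 => _ [B mB <-].
have bnd (r : probability Y R) : 0 <= fine (r B) <= 1.
  by rewrite fine_ge0//= -lee_fin fineK ?fin_num_measure// probability_le1.
have /andP[p0 p1] := bnd p; have /andP[q0 q1] := bnd q.
by rewrite ler_norml; lra.
Qed.

(** Two different laws on the curve disagree on some event [A]. The probability of [A] is continuous
    along the curve, its increments being dominated by total variation, so it takes every value
    between the two. *)
Lemma bernoulli_reducible_capacity_ge {R : realType} {X : Type}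
    {d : measure_display} {Y : measurableType d} (W : X -> probability Y R) :
  bernoulli_reducible W ->
  ((2^-1)%:E <= linearithmic_DI_capacity W unconstrained)%E.
Proof.
move=> [C [g [g_cont [s [t [s01 t01 nst]]]] ->] CW].
have [A [mA gst]] : exists A, measurable A /\ g s A <> g t A.
  apply: contrapT => nA; apply: nst => A mA; apply: contrapT => gst.
  by apply: nA; exists A.
pose f c := fine (g c A).
have gE c : g c A = (f c)%:E by rewrite fineK// fin_num_measure.
have f_cont : {within `[0, 1], continuous f}.
  apply/subspace_continuousP => x; rewrite set_itvE /= => x01.
  have := g_cont x x01.
  move=> /cvgr0Pnorm_lt tv0; apply/cvgrPdist_lt => e e0.
  apply: filterS (tv0 e e0) => y; apply: le_lt_trans.
  by apply: le_trans (ler_norm _); exact: measure_tv_distance.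
wlog st : s t s01 t01 {nst} gst / s < t.
  move=> H; have [|ts|st] := ltgtP s t; first exact: H.
    by apply: (H t s) => // gts; apply: gst.
  by rewrite st in gst.
have sub01 : `[s, t] `<=` `[0, 1].
  move=> x /=; move: s01 t01; rewrite !in_itv/= => /andP[s0 _] /andP[_ t1].
  by move=> /andP[sx xt]; rewrite (le_trans s0)// (le_trans xt).
have fs_ft : f s != f t.
  by apply/eqP => fst; apply: gst; rewrite !gE fst.
apply: (@linearithmic_DI_capacity_ge _ _ _ _ W unconstrained setT A
  (Num.min (f s) (f t)) (Num.max (f s) (f t))) => //.
  by rewrite gt_min !lt_max !ltxx/= orbF -neq_lt.
move=> v /andP[v1 v2].
have [|c cst fc] := IVT (ltW st) (continuous_subspaceW sub01 f_cont) (v := v).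
  by rewrite v1 v2.
have [|x xW] := CW (g c); first by exists c => //; exact: sub01.
by exists x => //; rewrite xW// gE fc.
Qed.

Lemma linearithmic_DI_capacity_eq {R : realType} {X : Type}
    {d : measure_display} {Y : measurableType d} (W : X -> probability Y R)
    (K : input_constraint (X := X)) :
  rate_half_quantization W K ->
  ((2^-1)%:E <= linearithmic_DI_capacity W K)%E ->
  linearithmic_DI_capacity W K = (2^-1)%:E.
Proof.
move=> quant ge; apply/eqP; rewrite eq_le ge andbT.
exact: linearithmic_DI_capacity_le.
Qed.

(** Any constraint between peak and average is treated at once. The embedding is [sqrt x], whose
    squares sum to at most [n * A]. For the lower bound the event is the output [0], whose
    probability [exp (- x)] sweeps the values from [exp (- A)] to [1]. *)
Lemma poisson_capacity_eq {R : realType} (A : R)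
    (K : input_constraint (X := {nonneg R})) : 0 < A ->
  (forall n u, poisson_peak A u -> K n u) ->
  (forall n u, K n u -> poisson_average A u) ->
  linearithmic_DI_capacity poisson_channel K = (2^-1)%:E.
Proof.
move=> A0 peakK Kavg; apply: linearithmic_DI_capacity_eq.
  apply: (@rate_half_quantization_embedding _ _ _ _ _ _
    (fun x : {nonneg R} => Num.sqrt x%:num) A) => [x y|n u /Kavg].
    exact: affinity_ge_poisson.
  rewrite /poisson_average /= => uA.
  under eq_bigr do rewrite sqr_sqrtr//.
  case: n u uA => [|n] u uA; first by rewrite big_ord0 mul0r.
  by rewrite -ler_pdivrMl// ltr0n.
apply: (@linearithmic_DI_capacity_ge _ _ _ _ poisson_channel K
  [set x | x%:num <= A] [set 0%N] (expR (- A)) 1) => //.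
- by rewrite expR_lt1 oppr_lt0.
- move=> t /andP[tA t1].
  have t0 : 0 < t by apply: lt_le_trans tA; exact: expR_gt0.
  have lt0 : 0 <= - ln t by rewrite oppr_ge0 ln_le0.
  exists (NngNum lt0); last first.
    by rewrite poisson_channelE /= opprK lnK ?posrE// expr0 fact0 divr1 mulr1.
  by rewrite /= lerNl -ler_expR lnK ?posrE.
Qed.

(** On []x, y]] the density lies between its value at [M] and its peak. The lower bound makes the
    distribution function strictly increasing, the upper one makes it Lipschitz. *)
Lemma normal_prob_itv {R : realType} (s M x y : R) : s != 0 -> x < y ->
  - M <= x -> y <= M ->
  (((y - x) * (normal_peak s * expR (- M ^+ 2 / (s ^+ 2 *+ 2))))%:E <=
   normal_prob 0 s `]x, y] <= ((y - x) * normal_peak s)%:E)%E.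
Proof.
move=> s0 xy Mx yM.
have len : (@lebesgue_measure R `]x, y] = (y - x)%:E)%E.
  by rewrite lebesgue_measure_itv/= lte_fin xy EFinB.
have mpdf : measurable_fun `]x, y] (EFin \o normal_pdf 0 s).
  by apply/measurable_EFinP/measurable_funTS; exact: measurable_normal_pdf.
apply/andP; split.
  rewrite mulrC EFinM -len -integral_cst//.
  apply: ge0_le_integral => //.
  - by move=> z _; rewrite lee_fin mulr_ge0 ?normal_peak_ge0 ?expR_ge0.
  move=> z /=; rewrite in_itv/= => /andP[xz zy].
  rewrite lee_fin normal_pdfE// ler_wpM2l ?normal_peak_ge0// ler_expR subr0.
  rewrite ler_wpM2r ?invr_ge0 ?mulrn_wge0 ?sqr_ge0// lerN2.
  nra.
rewrite mulrC EFinM -len -integral_cst//.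
apply: ge0_le_integral => //.
- by move=> z _; rewrite lee_fin normal_pdf_ge0.
- by move=> z _; rewrite lee_fin normal_pdf_ub.
Qed.

(** The embedding is [x / (2 * s)]. For the lower bound the event is a nonpositive output: at input
    [- c] its probability is the noise distribution function at [c], which sweeps an interval as [c]
    runs from [- sqrt A] to [sqrt A]. *)
Lemma gaussian_capacity_eq {R : realType} (s A : R)
    (K : input_constraint (X := R)) : 0 < s -> 0 < A ->
  (forall n u, gaussian_peak A u -> K n u) ->
  (forall n u, K n u -> gaussian_average A u) ->
  linearithmic_DI_capacity (gaussian_channel s) K = (2^-1)%:E.
Proof.
move=> s0 A0 peakK Kavg; apply: linearithmic_DI_capacity_eq.
  apply: (@rate_half_quantization_embedding _ _ _ _ _ _
    (fun x : R => x / (2 * s)) (A / (2 * s) ^+ 2)) => [x y|n u /Kavg].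
    exact: affinity_ge_gaussian.
  rewrite /gaussian_average /= => uA.
  under eq_bigr do rewrite expr_div_n.
  rewrite -mulr_suml mulrA ler_pM2r ?invr_gt0 ?exprn_gt0 ?mulr_gt0//.
  case: n u uA => [|n] u uA; first by rewrite big_ord0 mul0r.
  by rewrite -ler_pdivrMl// ltr0n.
pose f (z : R) := fine (normal_prob 0 s `]-oo, z]).
have fE z : normal_prob 0 s `]-oo, z] = (f z)%:E by rewrite fineK// fin_num_measure.
have sn0 : s != 0 by rewrite gt_eqF.
have f_diff x y : x < y -> ((f y - f x)%:E = normal_prob 0 s `]x, y])%E.
  move=> xy; rewrite EFinB -!fE.
  have -> : `]-oo, y]%classic = `]-oo, x] `|` `]x, y] :> set (measurableTypeR R).
    by rewrite -itv_bndbnd_setU// bnd_simp ltW.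
  rewrite measureU//; last first.
    by apply/seteqP; split => // z /=; rewrite !in_itv/= => -[? /andP[]]; lra.
  by rewrite addeAC subee ?add0e// fin_num_measure.
pose a : R := Num.sqrt A.
have a0 : 0 < a by rewrite sqrtr_gt0.
have peak0 : 0 < normal_peak s by exact: normal_peak_gt0.
have f_incr x y : - a <= x -> x < y -> y <= a ->
    0 < f y - f x <= (y - x) * normal_peak s.
  move=> ax xy ya; rewrite -lte_fin -lee_fin f_diff//.
  have /andP[lo ->] := normal_prob_itv sn0 xy ax ya; rewrite andbT.
  apply: lt_le_trans lo; rewrite lte_fin !mulr_gt0 ?expR_gt0//; lra.
have f_cont : {within `[- a, a], continuous f}.
  apply/subspace_continuousP => x; rewrite set_itvE /= => /andP[ax xa].
  apply/cvgrPdist_lt => e e0; rewrite near_withinE; apply/nbhs_ballP.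
  exists (e / normal_peak s) => [|y]; first exact: divr_gt0.
  rewrite /ball/= ltr_pdivlMr// set_itvE => xy /andP[ay ya].
  change (`|f x - f y| < e); apply: le_lt_trans xy.
  have [xy|yx|->] := ltgtP x y.
  - have /andP[d0 d1] := f_incr _ _ ax xy ya.
    by rewrite distrC (distrC x) !gtr0_norm// subr_gt0.
  - have /andP[d0 d1] := f_incr _ _ ay yx xa.
    by rewrite !gtr0_norm// subr_gt0.
  - by rewrite !subrr normr0 mul0r.
apply: (@linearithmic_DI_capacity_ge _ _ _ _ (gaussian_channel s) K
  [set x | x ^+ 2 <= A] `]-oo, 0] (f (- a)) (f a)) => //.
- have Naa : - a < a by lra.
  by have /andP[+ _] := f_incr _ _ (lexx _) Naa (lexx _); rewrite subr_gt0.
- move=> t /andP[t1 t2].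
  have aa : - a <= a by lra.
  have [|c] := IVT aa f_cont (v := t).
    by rewrite ge_min le_max t1 t2 orbT.
  rewrite in_itv/= => /andP[ac ca] fc; exists (- c).
    have -> : A = a ^+ 2 by rewrite sqr_sqrtr// ltW.
    rewrite /= sqrrN -subr_ge0 subr_sqr mulr_ge0//; lra.
  rewrite -fc -fE /gaussian_channel /distribution /pushforward /=.
  congr (normal_prob 0 s _); apply/seteqP; split => z /=;
    rewrite !in_itv/= /Defs.additive; lra.
Qed.

Theorem corollary11 (R : realType) :
  (forall (X : Type) (d : measure_display) (Y : measurableType d)
      (W : X -> probability Y R),
    bernoulli_reducible W ->
    ((2^-1 : R)%:E <= linearithmic_DI_capacity W unconstrained)%E)
  /\
  [/\ forall (X : Type) (d : measure_display) (Y : measurableType d)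
         (Q : X -> probability Y R)
         (k : nat) (C : 'I_k -> set (probability Y R))
         (residual : set (probability Y R)),
       discrete_alphabet Y ->
       (0 < k)%N ->
       (forall i, nontrivial_curve (C i)) ->
       (upper_minkowski_dim residual <= 1)%E ->
       channel_image Q = (\bigcup_i C i) `|` residual ->
       has_minkowski_dim (channel_image Q) 1 ->
       linearithmic_DI_capacity Q unconstrained = (2^-1 : R)%:E,
     forall A : R, 0 < A ->
       linearithmic_DI_capacity poisson_channel (poisson_peak A) =
         (2^-1 : R)%:E /\
       linearithmic_DI_capacity poisson_channel (poisson_average A) =
         (2^-1 : R)%:E
   & forall sigma A : R, 0 < sigma -> 0 < A ->
       linearithmic_DI_capacity (gaussian_channel sigma) (gaussian_peak A) =
         (2^-1 : R)%:E /\
       linearithmic_DI_capacity (gaussian_channel sigma) (gaussian_average A) =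
         (2^-1 : R)%:E].
Proof.
have average_le (n : nat) (A : R) (z : 'I_n -> R) : 0 < A ->
    (forall i, z i <= A) -> n%:R^-1 * \sum_(i < n) z i <= A.
  move=> A0 zA; case: n z zA => [|n] z zA; first by rewrite big_ord0 mulr0 ltW.
  rewrite ler_pdivrMl ?ltr0n//; apply: (@le_trans _ _ (\sum_(i < n.+1) A)).
    by apply: ler_sum.
  by rewrite sumr_const card_ord mulr_natl.
split; first by move=> X d Y W; exact: bernoulli_reducible_capacity_ge.
split.
- move=> X d Y Q k C residual dY k0 curveC _ imQ dim1.
  apply: linearithmic_DI_capacity_eq; first exact: rate_half_quantization_dim1.
  apply: bernoulli_reducible_capacity_ge.
  exists (C (Ordinal k0)); first exact: curveC.
  by rewrite imQ => p Cp; left; exists (Ordinal k0).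
- move=> A A0; split; apply: (poisson_capacity_eq A0) => // n u uA; exact: average_le.
- move=> s A s0 A0; split; apply: (gaussian_capacity_eq s0 A0) => // n u uA;
    exact: average_le.
Qed.
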